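(* Let $G$ and $H$ be locally compact groups and let $A=A_\pi$ be a closed translation-invariant subalgebra of $B(G)$. For a linear map $\varphi: A\to B(H)$, the following statements are equivalent: (i) $\varphi$ is an algebra homomorphism; (ii) $\varphi$ is bounded and $\varphi^*$ maps $H$ into $\Delta(A)\cup\{0\}$, where $\varphi^*: W^*(H)\to VN_\pi$ is the dual map of $\varphi$; (iii) there is an open subset $Y$ of $H$ and a continuous map $\alpha: Y\to\Delta(A)$ such that for all $u\in A$, $h\in H$, $$\varphi(u)(h)=j_\alpha(u)(h):=\begin{cases}\langle\alpha(h),u\rangle & h\in Y\\ 0 & h\in H\setminus Y.\end{cases}$$ When $\varphi$ is a homomorphism, $Y$ and $\alpha$ in (iii) are uniquely determined by $\varphi$ as follows: $Y=\{h\in H:\varphi^*(h)\neq0\}$ and $\alpha=\varphi^*|_Y$. If $A$ is unital, then $Y\in\Omega(H)$.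
   Context: Representations of $G$ are continuous unitary representations. $B(G)$ is the Fourier–Stieltjes algebra of $G$ (pointwise operations). For a representation $\{\pi,\mathcal H_\pi\}$ of $G$, $\xi*_\pi\eta(s)=\langle\pi(s)\xi|\eta\rangle$; $A_\pi$ is the closed linear span in $B(G)$ of all $\xi*_\pi\eta$ ($\xi,\eta\in\mathcal H_\pi$); $VN_\pi$ is the von Neumann algebra generated by $\pi(G)$, identified with $A_\pi^*$ via $\langle T,\xi*_\pi\eta\rangle=\langle T\xi|\eta\rangle$, so $\langle\pi(s),u\rangle=u(s)$. The closed translation-invariant subspaces of $B(G)$ are exactly the spaces $A_\pi$. $\omega_H$ is the universal representation of $H$, $B(H)=A_{\omega_H}$, $W^*(H)=VN_{\omega_H}=B(H)^*$, and $h\in H$ is identified with $\omega_H(h)\in W^*(H)$. $\Delta(A)\subseteq A^*=VN_\pi$ is the Gelfand spectrum of $A$ (nonzero multiplicative linear functionals) with the weak$^*$-topology. $\Omega(H)$ is the ring of subsets of $H$ generated by the open cosets of $H$ (cosets of open subgroups). *)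

(* Defs.v *)
From HB Require Import structures.
From mathcomp Require Import all_boot all_order all_algebra.
From mathcomp Require Import all_classical all_reals all_analysis.
From mathcomp Require Import complex ring.

Set Implicit Arguments.
Unset Strict Implicit.
Unset Printing Implicit Defensive.

Import Order.TTheory GRing.Theory Num.Theory.
Import numFieldNormedType.Exports.

Local Open Scope classical_set_scope.
Local Open Scope ring_scope.

HB.mixin Record isLCGroup G & Group G & Topological G := {
  mulg_continuous : continuous (fun p : G * G => (p.1 * p.2)%g);
  invg_continuous : continuous (fun g : G => g^-1%g);
  lcgroup_hausdorff : hausdorff_space G;
  lcgroup_locally_compact : locally_compact [set: G]
}.

#[short(type="lcGroupType")]
HB.structure Definition LCGroup := {G of Group G & Topological G & isLCGroup G}.

HB.mixin Record isHilbert (R : realType) V & CompleteNormedModule R[i] V := {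
  hdot : {dot V for Num.conj};
  hdotE : forall x : V, hdot x x = `|x| ^+ 2
}.

#[short(type="hilbertType")]
HB.structure Definition Hilbert (R : realType) :=
  {V of CompleteNormedModule R[i] V & isHilbert R V}.

Section DotNorm.
Variables (C : numClosedFieldType) (U : lmodType C) (f : {dot U for Num.conj}).

Lemma dot_CauchySchwarz u v :
  `|f u v| <= sqrtC (f u u) * sqrtC (f v v).
Proof.
rewrite -sqrtCM ?nnegrE ?dnorm_ge0 // -(sqrCK (normr_ge0 _)).
rewrite ler_sqrtC ?nnegrE ?exprn_ge0 ?mulr_ge0 ?dnorm_ge0 //.
have [->|v0] := eqVneq v 0.
  by rewrite !linear0r normr0 expr0n.
have vv : 0 < f v v by rewrite dnorm_gt0.
have := dnorm_ge0 f (u - (f u v / f v v) *: v).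
rewrite dnormB dnormZ linearZr_LR/=.
rewrite rmorphM fmorphV/= (CrealP (gtr0_real vv)).
set d := f u v; set b := f v v.
have -> : f u u + `|d / b| ^+ 2 * b -
    (d^* / b * d + (d^* / b * d)^*) = f u u - `|d| ^+ 2 / b.
  rewrite !(rmorphM, fmorphV)/= conjCK (CrealP (gtr0_real vv)).
  rewrite normrM normfV (gtr0_norm vv) exprMn normCK.
  have := lt0r_neq0 vv; rewrite -/b => b0.
  field.
  by [].
by rewrite subr_ge0 ler_pdivrMr.
Qed.

Lemma dot_triangle u v :
  sqrtC (f (u + v) (u + v)) <= sqrtC (f u u) + sqrtC (f v v).
Proof.
rewrite -[leRHS]sqrCK ?addr_ge0 ?sqrtC_ge0 ?dnorm_ge0 //.
rewrite ler_sqrtC ?nnegrE ?dnorm_ge0 ?exprn_ge0 ?addr_ge0 ?sqrtC_ge0 ?dnorm_ge0 //.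
rewrite dnormD sqrrD !sqrtCK addrAC lerD2r lerD2l.
rewrite (le_trans (real_ler_norm _)) //.
  by apply/CrealP; rewrite rmorphD /= conjCK addrC.
rewrite (le_trans (ler_normD _ _)) // norm_conjC -mulr2n lerMn2r/=.
exact: dot_CauchySchwarz.
Qed.

End DotNorm.

Lemma hilbert_normE (R : realType) (V : hilbertType R) (x : V) :
  `|x| = sqrtC (hdot x x).
Proof. by rewrite hdotE sqrCK. Qed.

Lemma hdotZl (R : realType) (V : hilbertType R) a (x y : V) :
  hdot (a *: x) y = a * hdot x y.
Proof. by rewrite linearZl_LR. Qed.

Lemma hdotZr (R : realType) (V : hilbertType R) a (x y : V) :
  hdot x (a *: y) = a^* * hdot x y.
Proof. by rewrite linearZr_LR. Qed.

Definition hsum (R : realType) (V W : hilbertType R) : Type := (V * W)%type.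

Section HilbertSum.
Variables (R : realType) (V W : hilbertType R).
Local Notation S := (hsum V W).

HB.instance Definition _ := GRing.Lmodule.copy S (V * W)%type.

Definition hsum_dot (x y : S) : R[i] := hdot x.1 y.1 + hdot x.2 y.2.

Lemma hsum_dot_bilinear :
  bilinear_for ( *%R) (Num.conj \; *%R) (hsum_dot : S -> S -> R[i]).
Proof.
split=> [y a x z|x a y z]; rewrite /hsum_dot/=.
  by rewrite !linearPl mulrDr addrACA.
by rewrite !linearPr/= mulrDr addrACA.
Qed.

HB.instance Definition _ := bilinear_isBilinear.Build R[i] S S R[i]
  ( *%R) (Num.conj \; *%R) hsum_dot hsum_dot_bilinear.

Lemma hsum_dot_hermitian (x y : S) :
  hsum_dot x y = (-1) ^+ false * (hsum_dot y x)^*.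
Proof.
rewrite /hsum_dot expr0 mul1r rmorphD/=.
by congr (_ + _); rewrite hermC expr0 mul1r.
Qed.

HB.instance Definition _ := isHermitianSesquilinear.Build R[i] S false
  Num.conj hsum_dot hsum_dot_hermitian.

Lemma hsum_dot_gt0 (x : S) : x != 0 -> 0 < hsum_dot x x.
Proof.
rewrite /hsum_dot => x0.
rewrite lt0r addr_ge0 ?dnorm_ge0// andbT paddr_eq0 ?dnorm_ge0//.
by rewrite !dnorm_eq0; move: x x0 => [a b].
Qed.

HB.instance Definition _ := isDotProduct.Build R[i] S hsum_dot hsum_dot_gt0.

Definition hsum_norm (x : S) : R[i] := sqrtC (hsum_dot x x).

Lemma hsum_normD (x y : S) : hsum_norm (x + y) <= hsum_norm x + hsum_norm y.
Proof. exact: (dot_triangle (hsum_dot : {dot S for Num.conj})). Qed.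

Lemma hsum_normZ (a : R[i]) (x : S) : hsum_norm (a *: x) = `|a| * hsum_norm x.
Proof.
rewrite /hsum_norm (dnormZ (hsum_dot : {dot S for Num.conj})).
by rewrite sqrtCM ?nnegrE ?exprn_ge0 ?sqrCK ?dnorm_ge0.
Qed.

Lemma hsum_norm_eq0 (x : S) : hsum_norm x = 0 -> x = 0.
Proof. by move/eqP; rewrite sqrtC_eq0 dnorm_eq0 => /eqP. Qed.

HB.instance Definition _ := Lmodule_isNormed.Build R[i] S
  hsum_normD hsum_normZ hsum_norm_eq0.

Lemma hsum_normE (x : S) : `|x| = sqrtC (`|x.1| ^+ 2 + `|x.2| ^+ 2).
Proof. by rewrite -!hdotE. Qed.

Lemma hsum_norm1 (x : S) : `|x.1| <= `|x|.
Proof.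
rewrite hsum_normE -[leLHS]sqrCK// ler_sqrtC ?nnegrE ?addr_ge0 ?exprn_ge0//.
by rewrite lerDl exprn_ge0.
Qed.

Lemma hsum_norm2 (x : S) : `|x.2| <= `|x|.
Proof.
rewrite hsum_normE -[leLHS]sqrCK// ler_sqrtC ?nnegrE ?addr_ge0 ?exprn_ge0//.
by rewrite lerDr exprn_ge0.
Qed.

Lemma hsum_norm_le (x : S) : `|x| <= `|x.1| + `|x.2|.
Proof.
rewrite hsum_normE -[leRHS]sqrCK ?addr_ge0//.
rewrite ler_sqrtC ?nnegrE ?addr_ge0 ?exprn_ge0 ?addr_ge0//.
by rewrite sqrrD addrAC lerDl mulrn_wge0// mulr_ge0.
Qed.

Lemma hsum_complete (F : set_system S) : ProperFilter F -> cauchy F -> cvg F.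
Proof.
move=> FF /cauchyP Fc.
have F1 : cvg ((fst : S -> V) @ F).
  apply: cauchy_cvg; apply/cauchyP => e e0.
  have [x Fx] := Fc e e0; exists x.1; rewrite /fmap/=.
  apply: filterS Fx => y; rewrite -!ball_normE/=; apply: le_lt_trans.
  exact: (hsum_norm1 (x - y)).
have F2 : cvg ((snd : S -> W) @ F).
  apply: cauchy_cvg; apply/cauchyP => e e0.
  have [x Fx] := Fc e e0; exists x.2; rewrite /fmap/=.
  apply: filterS Fx => y; rewrite -!ball_normE/=; apply: le_lt_trans.
  exact: (hsum_norm2 (x - y)).
move/cvg_ex: F1 => -[a Fa]; move/cvg_ex: F2 => -[b Fb].
apply/cvg_ex; exists ((a, b) : S); apply/cvgrPdist_lt => e e0.
have e2 : 0 < e / 2 by rewrite divr_gt0.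
move/cvgrPdist_lt: Fa => /(_ _ e2) Fa; move/cvgrPdist_lt: Fb => /(_ _ e2) Fb.
near=> x; rewrite (le_lt_trans (hsum_norm_le _))//.
rewrite [ltRHS]splitr ltrD//=; near: x; [exact: Fa|exact: Fb].
Unshelve. all: by end_near. Qed.

HB.instance Definition _ := Uniform_isComplete.Build S hsum_complete.

Lemma hsum_dotE (x : S) : hsum_dot x x = `|x| ^+ 2.
Proof. by rewrite sqrtCK. Qed.

HB.instance Definition _ := isHilbert.Build R S hsum_dotE.

End HilbertSum.

Definition hzero (R : realType) : Type := unit.

Section HilbertZero.
Variable R : realType.
Local Notation Z := (hzero R).

HB.instance Definition _ := Choice.copy Z unit.

Let hzero_add (x y : Z) : Z := tt.
Let hzero_opp (x : Z) : Z := tt.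
Let hzero_addA : associative hzero_add. Proof. by []. Qed.
Let hzero_addC : commutative hzero_add. Proof. by []. Qed.
Let hzero_add0 : left_id (tt : Z) hzero_add. Proof. by case. Qed.
Let hzero_addN : left_inverse (tt : Z) hzero_opp hzero_add. Proof. by []. Qed.

HB.instance Definition _ := GRing.isZmodule.Build Z
  hzero_addA hzero_addC hzero_add0 hzero_addN.

Let hzero_scale (a : R[i]) (x : Z) : Z := tt.

Let hzero_scaleA a b v :
  hzero_scale a (hzero_scale b v) = hzero_scale (a * b) v.
Proof. by []. Qed.
Let hzero_scale1 : left_id 1 hzero_scale. Proof. by case. Qed.
Let hzero_scaleDr : right_distributive hzero_scale +%R. Proof. by []. Qed.
Let hzero_scaleDl v : {morph hzero_scale^~ v : a b / a + b}.
Proof. by []. Qed.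

HB.instance Definition _ := GRing.Zmodule_isLmodule.Build R[i] Z
  hzero_scaleA hzero_scale1 hzero_scaleDr hzero_scaleDl.

Definition hzero_dot (x y : Z) : R[i] := 0.

Let hzero_dot_bilinear :
  bilinear_for ( *%R) (Num.conj \; *%R) (hzero_dot : Z -> Z -> R[i]).
Proof.
by split=> [y a x z|x a y z]; apply/esym; rewrite /hzero_dot addr0; apply: mulr0.
Qed.

HB.instance Definition _ := bilinear_isBilinear.Build R[i] Z Z R[i]
  ( *%R) (Num.conj \; *%R) hzero_dot hzero_dot_bilinear.

Let hzero_dot_hermitian (x y : Z) :
  hzero_dot x y = (-1) ^+ false * (hzero_dot y x)^*.
Proof. by rewrite /hzero_dot rmorph0 mulr0. Qed.

HB.instance Definition _ := isHermitianSesquilinear.Build R[i] Z false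
  Num.conj hzero_dot hzero_dot_hermitian.

Let hzero_dot_gt0 (x : Z) : x != 0 -> 0 < hzero_dot x x.
Proof. by case: x. Qed.

HB.instance Definition _ := isDotProduct.Build R[i] Z hzero_dot hzero_dot_gt0.

Let hzero_norm (x : Z) : R[i] := 0.

Let hzero_normD (x y : Z) :
  hzero_norm (x + y) <= hzero_norm x + hzero_norm y.
Proof. by rewrite addr0. Qed.
Let hzero_normZ (a : R[i]) (x : Z) :
  hzero_norm (a *: x) = `|a| * hzero_norm x.
Proof. by rewrite mulr0. Qed.
Let hzero_norm_eq0 (x : Z) : hzero_norm x = 0 -> x = 0.
Proof. by case: x. Qed.

HB.instance Definition _ := Lmodule_isNormed.Build R[i] Z
  hzero_normD hzero_normZ hzero_norm_eq0.

Let hzero_complete (F : set_system Z) : ProperFilter F -> cauchy F -> cvg F.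
Proof.
move=> FF _; apply/cvg_ex; exists tt; apply/cvgrPdist_lt => e e0.
by apply: nearW => -[]; rewrite [`| _ |]/(0 : R[i]).
Qed.

HB.instance Definition _ := Uniform_isComplete.Build Z hzero_complete.

Let hzero_dotE (x : Z) : hzero_dot x x = `|x| ^+ 2.
Proof. by rewrite [`| _ |]/(0 : R[i]) expr0n. Qed.

HB.instance Definition _ := isHilbert.Build R Z hzero_dotE.

End HilbertZero.

(* Each [urep_act s] is isometric and, by the two homomorphism laws, invertible,
   hence unitary; continuity is for the strong operator topology. *)
Record urep (R : realType) (G : lcGroupType) := URep {
  urep_space :> hilbertType R;
  urep_act : G -> {linear urep_space -> urep_space};
  urep_act1 : forall x, urep_act 1%g x = x;
  urep_actM : forall s t x, urep_act (s * t)%g x = urep_act s (urep_act t x);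
  urep_act_dot : forall s x y, hdot (urep_act s x) (urep_act s y) = hdot x y;
  urep_act_continuous : forall x, continuous (fun s => urep_act s x)
}.

Definition coef (R : realType) (G : lcGroupType) (pi : urep R G)
  (xi eta : pi) : G -> R[i]^o := fun s => hdot (urep_act pi s xi) eta.

Section RepSum.
Variables (R : realType) (G : lcGroupType).

Section Sum.
Variables pi sigma : urep R G.

Definition rsum_act (s : G) (x : hsum pi sigma) : hsum pi sigma :=
  (urep_act pi s x.1, urep_act sigma s x.2).

Let rsum_act_linear s : linear (rsum_act s).
Proof. by move=> a x y; rewrite /rsum_act !linearP. Qed.

HB.instance Definition _ s := GRing.isLinear.Build R[i] _ _ _ (rsum_act s)
  (rsum_act_linear s).

Let rsum_act1 x : rsum_act 1%g x = x.
Proof. by rewrite /rsum_act !urep_act1; case: x. Qed.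

Let rsum_actM s t x : rsum_act (s * t)%g x = rsum_act s (rsum_act t x).
Proof. by rewrite /rsum_act !urep_actM. Qed.

Let rsum_act_dot s x y : hdot (rsum_act s x) (rsum_act s y) = hdot x y.
Proof. by rewrite /= /hsum_dot !urep_act_dot. Qed.

Let rsum_act_continuous x : continuous (rsum_act^~ x).
Proof.
move=> s; apply/cvgrPdist_lt => e e0.
have e2 : 0 < e / 2 by rewrite divr_gt0.
have /cvgrPdist_lt/(_ _ e2) H1 := @urep_act_continuous _ _ pi x.1 s.
have /cvgrPdist_lt/(_ _ e2) H2 := @urep_act_continuous _ _ sigma x.2 s.
near=> t; rewrite (le_lt_trans (hsum_norm_le _))//.
rewrite [ltRHS]splitr ltrD//=; near: t; [exact: H1|exact: H2].
Unshelve. all: by end_near. Qed.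

Definition rsum : urep R G :=
  @URep R G (hsum pi sigma) rsum_act rsum_act1 rsum_actM rsum_act_dot
    rsum_act_continuous.

Lemma coef_rsum (x x' : pi) (y y' : sigma) :
  @coef R G rsum (x, y) (x', y') = coef x x' + coef y y'.
Proof. by apply/funext => s. Qed.

End Sum.

Let rzero_act (s : G) : {linear hzero R -> hzero R} := idfun.

Let rzero_act_continuous x : continuous (rzero_act^~ x).
Proof. by move=> s; apply: cvg_cst. Qed.

Definition rzero : urep R G :=
  @URep R G (hzero R) rzero_act (fun=> erefl) (fun _ _ => fun=> erefl)
   (fun _ _ _ => erefl) rzero_act_continuous.

Lemma coef_rzero : @coef R G rzero 0 0 = 0.
Proof. by apply/funext => s. Qed.

Lemma coefZ (pi : urep R G) a (x y : pi) : coef (a *: x) y = a *: coef x y.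
Proof. by apply/funext => s; rewrite /coef linearZ_LR (hdotZl a (urep_act pi s x)). Qed.

Lemma coef0 (pi : urep R G) (x : pi) : coef 0 x = 0.
Proof. by apply/funext => s; rewrite /coef linear0 linear0l. Qed.

Lemma coef_scale (pi : urep R G) (a : R[i]) (x y : pi) : 0 < a ->
  coef (a^-1 *: x) (a *: y) = coef x y.
Proof.
move=> a0; apply/funext => s; rewrite /coef hdotZr linearZ_LR (hdotZl _ (urep_act pi s x)).
by rewrite (CrealP (gtr0_real a0)) mulrA mulfV ?mul1r// gt_eqF.
Qed.

Lemma urep_act_norm (pi : urep R G) s (x : pi) : `|urep_act pi s x| = `|x|.
Proof. by rewrite !hilbert_normE urep_act_dot. Qed.

Lemma coef_le (pi : urep R G) (x y : pi) s : `|coef x y s : R[i]| <= `|x| * `|y|.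
Proof.
rewrite -(urep_act_norm s x) [X in X * _]hilbert_normE [X in _ * X]hilbert_normE.
exact: dot_CauchySchwarz.
Qed.

(* Balancing the two vectors turns the product of norms into a sum of squares. *)
Lemma coef_balance (pi : urep R G) (x y : pi) :
  exists x' y' : pi, [/\ coef x' y' = coef x y,
    `|x'| ^+ 2 = `|x| * `|y| & `|y'| ^+ 2 = `|x| * `|y|].
Proof.
have [->|x0] := eqVneq x 0.
  by exists 0, 0; rewrite !coef0 normr0 mul0r expr0n.
have [->|y0] := eqVneq y 0.
  exists 0, 0; rewrite coef0 normr0 mulr0 expr0n; split => //.
  by apply/funext => s; rewrite /coef linear0r.
have xy : 0 < `|x| / `|y| by rewrite divr_gt0 ?normr_gt0.
pose a := sqrtC (`|x| / `|y|).
have a0 : 0 < a by rewrite sqrtC_gt0.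
have aa : a ^+ 2 = `|x| / `|y| by rewrite sqrtCK.
exists (a^-1 *: x), (a *: y); split; first exact: coef_scale.
  rewrite normrZ exprMn ger0_norm ?invr_ge0 ?ltW// exprVn aa invf_div.
  by rewrite expr2 mulrA divfK ?normr_eq0// mulrC.
rewrite normrZ exprMn ger0_norm ?ltW// aa.
by rewrite expr2 mulrA divfK ?normr_eq0.
Qed.

End RepSum.

Section RealComplex.
Variable R : realType.
Implicit Types (a b : R) (z : R[i]).

Let rcD a b : (a + b)%:C%C = a%:C%C + b%:C%C :> R[i].
Proof. exact: (rmorphD (real_complex R)). Qed.

Let rcM a b : (a * b)%:C%C = a%:C%C * b%:C%C :> R[i].
Proof. exact: (rmorphM (real_complex R)). Qed.

Let rcV a : (a^-1)%:C%C = (a%:C%C)^-1 :> R[i].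
Proof. exact: (fmorphV (real_complex R)). Qed.

Let rcRe z : 0 <= z -> (complex.Re z)%:C%C = z.
Proof. by move=> z0; rewrite RRe_real// ger0_real. Qed.

Definition rcE := (rcD, rcM, rcV).
Definition rcReE := rcRe.

End RealComplex.

Definition fs_pred (R : realType) (G : lcGroupType) : {pred G -> R[i]^o} :=
  [pred u | `[< exists (pi : urep R G) (xi eta : pi), u = coef xi eta >]].
Arguments fs_pred : clear implicits.

(* The Fourier-Stieltjes algebra B(G), as a space of functions on G. *)
Record FS (R : realType) (G : lcGroupType) :=
  MkFS { fsval :> G -> R[i]^o; fsvalP : fsval \in fs_pred R G }.

Section FourierStieltjes.
Variables (R : realType) (G : lcGroupType).
Local Notation B := (FS R G).

Lemma fs_predP (u : G -> R[i]^o) :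
  reflect (exists (pi : urep R G) (xi eta : pi), u = coef xi eta)
    (u \in fs_pred R G).
Proof. exact: asboolP. Qed.

Lemma coef_fs (pi : urep R G) (x y : pi) : coef x y \in fs_pred R G.
Proof. by apply/fs_predP; exists pi, x, y. Qed.

Lemma fs_pred_submod : submod_closed (fs_pred R G).
Proof.
split; first by rewrite -coef_rzero coef_fs.
move=> a _ _ /fs_predP[pi [x [y ->]]] /fs_predP[sigma [x' [y' ->]]].
by rewrite -coefZ -coef_rsum coef_fs.
Qed.

HB.instance Definition _ := GRing.isSubmodClosed.Build _ _ (fs_pred R G)
  fs_pred_submod.
HB.instance Definition _ := [isSub for @fsval R G].
HB.instance Definition _ := [Choice of B by <:].
HB.instance Definition _ := [SubChoice_isSubLmodule of B by <:].

Lemma fsvalD (u v : B) : fsval (u + v) = fsval u + fsval v.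
Proof. by []. Qed.

Lemma fsvalZ (k : R[i]) (u : B) : fsval (k *: u) = k *: fsval u.
Proof. by []. Qed.

Definition fs_coef (pi : urep R G) (xi eta : pi) : B := MkFS (coef_fs xi eta).

(* The infimum of `|xi| * `|eta| over all coefficient representations of u, which
   is the norm of u as a functional on the group C*-algebra of G. *)
Definition fs_norms (u : B) : set R :=
  [set r | exists (pi : urep R G) (xi eta : pi),
    fsval u = coef xi eta /\ r%:C%C = `|xi| * `|eta|].

Definition fs_norm (u : B) : R[i] := (inf (fs_norms u))%:C%C.

Lemma fs_norms_coef (u : B) (pi : urep R G) (x y : pi) :
  fsval u = coef x y -> fs_norms u (complex.Re (`|x| * `|y|)).
Proof.
by move=> uE; exists pi, x, y; split=> //; rewrite rcReE// mulr_ge0.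
Qed.

Lemma fs_norms_neq0 (u : B) : fs_norms u !=set0.
Proof.
have /fs_predP[pi [x [y uE]]] := fsvalP u.
by exists (complex.Re (`|x| * `|y|)); exact: fs_norms_coef.
Qed.

Lemma fs_norms_ge0 (u : B) r : fs_norms u r -> 0 <= r.
Proof.
by move=> [pi [x [y [_ rE]]]]; rewrite -ler0c rE mulr_ge0.
Qed.

Lemma fs_norms_lb (u : B) : lbound (fs_norms u) 0.
Proof. by move=> r; apply: fs_norms_ge0. Qed.

Lemma fs_norms_inf (u : B) : has_inf (fs_norms u).
Proof. by split; [exact: fs_norms_neq0|exists 0; exact: fs_norms_lb]. Qed.

Lemma fs_norms_le (u : B) r : fs_norms u r -> inf (fs_norms u) <= r.
Proof. by apply: ge_inf; exists 0; exact: fs_norms_lb. Qed.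

Lemma fs_normsD (u v : B) a b :
  fs_norms u a -> fs_norms v b -> fs_norms (u + v) (a + b).
Proof.
move=> [pi [x [y [uE aE]]]] [sigma [x' [y' [vE bE]]]].
have [x1 [y1 [e1 nx1 ny1]]] := coef_balance x y.
have [x2 [y2 [e2 nx2 ny2]]] := coef_balance x' y'.
exists (rsum pi sigma), (x1, x2), (y1, y2); split.
  by rewrite fsvalD uE vE -e1 -e2 -coef_rsum.
by rewrite !hsum_normE/= nx1 nx2 ny1 ny2 -aE -bE -expr2 sqrtCK rcE.
Qed.

Lemma fs_normsZ (u : B) k r : fs_norms u r -> fs_norms (k *: u) (complex.Re `|k| * r).
Proof.
move=> [pi [x [y [uE rE]]]]; exists pi, (k *: x), y; split.
  by rewrite fsvalZ uE -coefZ.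
by rewrite rcE rcReE// rE normrZ mulrA.
Qed.

Lemma fs_normD (u v : B) : fs_norm (u + v) <= fs_norm u + fs_norm v.
Proof.
rewrite /fs_norm -rcE lecR -lerBlDr; apply: lb_le_inf => [|a ua].
  exact: fs_norms_neq0.
rewrite lerBlDr -lerBlDl; apply: lb_le_inf => [|b vb].
  exact: fs_norms_neq0.
by rewrite lerBlDl; apply: fs_norms_le; exact: fs_normsD.
Qed.

Lemma fs_normZ (k : R[i]) (u : B) : fs_norm (k *: u) = `|k| * fs_norm u.
Proof.
have le k' v : inf (fs_norms (k' *: v)) <= complex.Re `|k'| * inf (fs_norms v).
  have [->|k0] := eqVneq k' 0.
    rewrite normr0 mul0r; apply: fs_norms_le.
    have [r ur] := fs_norms_neq0 v.
    by have := fs_normsZ 0 ur; rewrite normr0 mul0r.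
  have kp : 0 < complex.Re `|k'| by rewrite -ltcR rcReE// normr_gt0.
  rewrite -ler_pdivrMl//; apply: lb_le_inf => [|r vr].
    exact: fs_norms_neq0.
  by rewrite ler_pdivrMl//; apply: fs_norms_le; exact: fs_normsZ.
rewrite /fs_norm -[X in X * _]rcReE// -rcE.
congr (_%:C%C); apply/eqP; rewrite eq_le le andTb.
have [->|k0] := eqVneq k 0.
  by rewrite normr0 mul0r; exact: lb_le_inf (fs_norms_neq0 _) (@fs_norms_lb _).
have kp : 0 < complex.Re `|k| by rewrite -ltcR rcReE// normr_gt0.
have := le k^-1 (k *: u); rewrite scalerA mulVf// scale1r normfV.
have -> : complex.Re (`|k|^-1) = (complex.Re `|k|)^-1.
  apply: (@complexI R); rewrite [RHS]rcE (rcReE (normr_ge0 k)).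
  by apply: rcReE; rewrite invr_ge0.
by rewrite ler_pdivlMl.
Qed.

Lemma fs_eval_le (u : B) s : `|u s : R[i]| <= fs_norm u.
Proof.
rewrite /fs_norm -(rcReE (normr_ge0 (u s : R[i]))) lecR.
apply: lb_le_inf => [|r [pi [x [y [-> rE]]]]]; first exact: fs_norms_neq0.
by rewrite -lecR rE rcReE//; exact: coef_le.
Qed.

Lemma fs_norm_eq0 (u : B) : fs_norm u = 0 -> u = 0.
Proof.
move=> u0; apply: val_inj; apply/funext => s.
have := fs_eval_le u s; rewrite u0 normr_le0 => /eqP; exact.
Qed.

HB.instance Definition _ := Lmodule_isNormed.Build R[i] B
  fs_normD fs_normZ fs_norm_eq0.

End FourierStieltjes.

Definition fs_coefs (R : realType) (G : lcGroupType) (pi : urep R G) :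
  set (FS R G) := [set u | exists xi eta : pi, u = fs_coef xi eta].

(* The closed linear span of the coefficients, as the least closed subspace
   containing them. *)
Definition Api_pred (R : realType) (G : lcGroupType) (pi : urep R G) :
    {pred FS R G} :=
  [in smallest [set W | closed W /\ submod_closed [in W]] (fs_coefs pi)].

Record Api (R : realType) (G : lcGroupType) (pi : urep R G) :=
  MkApi { apival :> FS R G; apivalP : apival \in Api_pred pi }.

Section Api.
Variables (R : realType) (G : lcGroupType) (pi : urep R G).
Local Notation A := (Api pi).

Lemma Api_predP (u : FS R G) :
  reflect (forall W : set (FS R G), closed W -> submod_closed [in W] ->
      fs_coefs pi `<=` W -> W u) (u \in Api_pred pi).
Proof.
apply: (iffP idP) => [|uW].
  by move=> /set_mem + W cW sW piW; apply; split.
by apply/mem_set => W [[cW sW] piW]; apply: uW.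
Qed.

Lemma Api_pred_submod : submod_closed (Api_pred pi).
Proof.
split; first by apply/Api_predP => W _ [/set_mem].
move=> a u v /Api_predP uA /Api_predP vA.
apply/Api_predP => W cW sW piW; have [_ linW] := sW.
by apply/set_mem/linW; apply/mem_set; [exact: uA|exact: vA].
Qed.

HB.instance Definition _ := GRing.isSubmodClosed.Build _ _ (Api_pred pi)
  Api_pred_submod.
HB.instance Definition _ := [isSub for @apival R G pi].
HB.instance Definition _ := [Choice of A by <:].
HB.instance Definition _ := [SubChoice_isSubLmodule of A by <:].

Definition Api_norm (u : A) : R[i] := `|apival u|.

Lemma Api_normD (u v : A) : Api_norm (u + v) <= Api_norm u + Api_norm v.
Proof. exact: ler_normD. Qed.

Lemma Api_normZ (a : R[i]) (u : A) : Api_norm (a *: u) = `|a| * Api_norm u.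
Proof. exact: normrZ. Qed.

Lemma Api_norm_eq0 (u : A) : Api_norm u = 0 -> u = 0.
Proof. by move=> /normr0_eq0 u0; apply: val_inj. Qed.

HB.instance Definition _ := Lmodule_isNormed.Build R[i] A
  Api_normD Api_normZ Api_norm_eq0.

End Api.

Definition bounded_map (R : realType) (E F : normedModType R[i]) (f : E -> F) :=
  exists M : R[i], forall x, `|f x| <= M * `|x|.

(* As a subset of [{ptws E -> R[i]^o}] the dual carries the weak* topology. *)
Definition dual (R : realType) (E : normedModType R[i]) :
    set {ptws E -> R[i]^o} :=
  [set T : E -> R[i]^o | linear T /\ bounded_map T].
Arguments dual {R} E _.

(* The von Neumann algebras VN_pi and W^*(H), in their identification with the
   duals of A_pi and B(H). *)
Definition VN (R : realType) (G : lcGroupType) (pi : urep R G) :=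
  dual (Api pi).
Arguments VN {R G} pi _.

Definition Wstar (R : realType) (H : lcGroupType) := dual (FS R H).
Arguments Wstar : clear implicits.

(* The element omega_H(h) of W^*(H). *)
Definition omega (R : realType) (H : lcGroupType) (h : H) :
  FS R H -> R[i]^o := fun u => u h.

Lemma omega_Wstar (R : realType) (H : lcGroupType) (h : H) :
  Wstar R H (omega h).
Proof.
by split=> //; exists 1 => u; rewrite mul1r; exact: fs_eval_le.
Qed.

Definition adjoint (R : realType) (E F : normedModType R[i]) (phi : E -> F)
  (T : F -> R[i]^o) : E -> R[i]^o := T \o phi.

Lemma adjoint_dual (R : realType) (E F : normedModType R[i])
    (phi : {linear E -> F}) (T : F -> R[i]^o) :
  bounded_map phi -> dual F T -> dual E (adjoint phi T).
Proof.
move=> [M phiM] [linT [N TN]]; split.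
  by move=> a u v; rewrite /adjoint/= linearP linT.
have [N0|N0] := boolP (0 <= N).
  exists (N * M) => u; rewrite (le_trans (TN _))//.
  by rewrite -mulrA ler_wpM2l.
exists 0 => u; rewrite mul0r /adjoint/=; have := TN (phi u).
have [->|pu] := eqVneq (phi u) 0; first by rewrite normr0 mulr0.
move=> /(le_trans (normr_ge0 _)).
by rewrite pmulr_lge0 ?normr_gt0// (negbTE N0).
Qed.

(* Products in B(G) are pointwise. Being the product of u and v is stated as a
   relation on their values. *)
Definition is_mul (R : realType) (X : Type) (u v w : X -> R[i]^o) :=
  forall x, w x = u x * v x.

Definition subalgebra (R : realType) (G : lcGroupType) (pi : urep R G) :=
  forall u v : Api pi, exists w : Api pi, is_mul u v w.

(* A_pi has an identity element; this allows A_pi = 0. *)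
Definition unital (R : realType) (G : lcGroupType) (pi : urep R G) :=
  exists e : Api pi, forall u : Api pi, is_mul e u u.

Definition algebra_hom (R : realType) (G H : lcGroupType) (pi : urep R G)
    (phi : {linear Api pi -> FS R H}) :=
  forall u v w : Api pi, is_mul u v w -> is_mul (phi u) (phi v) (phi w).

Definition spectrum (R : realType) (G : lcGroupType) (pi : urep R G) :
    set {ptws Api pi -> R[i]^o} :=
  [set T | [/\ VN pi T, T <> (0 : Api pi -> R[i]^o) &
    forall u v w : Api pi, is_mul u v w -> T w = (T u * T v)%R]].
Arguments spectrum {R G} pi _.

Definition jmap (R : realType) (G H : lcGroupType) (pi : urep R G)
    (Y : set H) (alpha : Y -> spectrum pi) (u : Api pi) (h : H) : R[i]^o :=
  if pselect (Y h) is left Yh then \val (alpha (exist _ h (mem_set Yh))) u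
  else 0.

Definition represents (R : realType) (G H : lcGroupType) (pi : urep R G)
    (phi : {linear Api pi -> FS R H}) (Y : set H) (alpha : Y -> spectrum pi) :=
  [/\ open Y, continuous alpha &
    forall (u : Api pi) (h : H), phi u h = jmap alpha u h].

Definition subgroup (H : lcGroupType) (K : set H) :=
  [/\ K 1%g, forall x y, K x -> K y -> K (x * y)%g &
    forall x, K x -> K x^-1%g].

Definition open_cosets (H : lcGroupType) : set (set H) :=
  [set X | exists (K : set H) (h : H),
    [/\ subgroup K, open K & X = [set (h * k)%g | k in K]]].
Arguments open_cosets : clear implicits.

Definition Omega (H : lcGroupType) : set (set H) := <<r open_cosets H >>.
Arguments Omega : clear implicits.

(* Main.v *)
From HB Require Import structures.
Require Import Defs.
From mathcomp Require Import all_boot all_order all_algebra.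
From mathcomp Require Import all_classical all_reals all_analysis.
From mathcomp Require Import complex ring lra.

(** Passing between (ii) and (iii), from (iii) to (i), and the uniqueness of Y and alpha only
    involve evaluating phi u at the points of H.  Two facts carry the rest: a homomorphism is
    bounded, and an idempotent of B(H) is the indicator function of a set in the coset ring.

    Boundedness.  A geometrically dominated series in B(G) converges: its sum is a coefficient
    of the l2 direct sum of the representations of the terms ([fs_series]).  Hence B(H) and
    A_pi, which is closed in B(G), are Banach spaces.  On these, countably subadditive
    seminorms are bounded ([zabreiko]), which contains the closed graph theorem
    ([closed_graph]) and the uniform boundedness principle.  Together these show that the
    pointwise product of A_pi is jointly bounded ([mul_jointly_bounded]); so small elements of
    A_pi have convergent geometric series, and multiplicative functionals on A_pi are bounded
    ([character_bounded]).  The maps sending u to phi u h are such functionals, and the closed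
    graph theorem gives that phi is bounded.

    Idempotents.  Let the idempotent be the coefficient s |-> <s x, eta> of a unitary
    representation; x may be taken in the cyclic subspace generated by eta.  More generally
    consider the vectors x of this subspace whose coefficient against eta is integer-valued.
    Two distinct such vectors have at least a fixed distance, because a small one has
    coefficient 0.  Therefore passing from an orbit to a weak accumulation point of it lowers
    the squared norm by a fixed amount ([norm_drop]), and the orbit of x /= 0 has a nonzero
    weak limit y whose own orbit accumulates at most at 0 ([vanishing_limit]).  The coefficient
    of y is nonzero at finitely many points of the orbit of y only, and is thus a finite
    combination of indicator functions of cosets of the stabilizer of y, which is open
    ([vanishing_simple]).  Moreover |y|^2, being a limit of inner products of x with points of
    the orbit of y, is one of them, say <x, v> = |y|^2 = |v|^2 ([split_vanishing]).  Then x - v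
    has integer-valued coefficient and |x - v|^2 = |x|^2 - |v|^2, and induction on the squared
    norm shows that the coefficient of x is a finite combination of indicator functions of open
    cosets.  If A_pi has an identity e, this applies to phi e, which is 1 exactly on Y. *)

Set Implicit Arguments.
Unset Strict Implicit.
Unset Printing Implicit Defensive.

Import Order.TTheory GRing.Theory Num.Theory.
Import numFieldNormedType.Exports.

Local Open Scope classical_set_scope.
Local Open Scope ring_scope.

(** * Real-valued norms and inner products *)

(** Norms over the complex numbers are themselves complex, hence only partially
    ordered; real values make case distinctions and linear arithmetic available. *)
Definition rnorm (R : realType) (V : normedZmodType R[i]) (x : V) : R :=
  complex.Re `|x|.

Section RealNorm.
Variables (R : realType) (V : normedZmodType R[i]).
Implicit Types x y : V.

Lemma rnormE x : `|x| = (rnorm x)%:C%C.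
Proof. by rewrite /rnorm rcReE. Qed.

Lemma rnorm_ge0 x : 0 <= rnorm x.
Proof. by rewrite -ler0c -rnormE. Qed.

Lemma rnormD x y : rnorm (x + y) <= rnorm x + rnorm y.
Proof. by rewrite -lecR rcE -!rnormE ler_normD. Qed.

Lemma rnormN x : rnorm (- x) = rnorm x.
Proof. by rewrite /rnorm normrN. Qed.

Lemma rnormB x y : rnorm (x - y) = rnorm (y - x).
Proof. by rewrite /rnorm distrC. Qed.

Lemma rnorm0 : rnorm (0 : V) = 0.
Proof. by rewrite /rnorm normr0. Qed.

Lemma rnorm_eq0 x : (rnorm x == 0) = (x == 0).
Proof.
by rewrite -[RHS]normr_eq0 rnormE; apply/eqP/eqP => [->|[]].
Qed.

Lemma rnorm_gt0 x : (0 < rnorm x) = (x != 0).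
Proof. by rewrite lt_neqAle rnorm_ge0 andbT eq_sym rnorm_eq0. Qed.

Lemma rnorm_sum (I : Type) (r : seq I) (P : pred I) (F : I -> V) :
  rnorm (\sum_(i <- r | P i) F i) <= \sum_(i <- r | P i) rnorm (F i).
Proof.
elim/big_rec2: _ => [|i y x _ le]; first by rewrite rnorm0.
by rewrite (le_trans (rnormD _ _))// lerD2l.
Qed.

End RealNorm.

Section RealNormScalar.
Variables (R : realType).
Implicit Types z w : R[i].

Lemma rnormM z w : rnorm (z * w) = rnorm z * rnorm w.
Proof. by apply: (@complexI R); rewrite rcE -!rnormE normrM. Qed.

Lemma rnormC (r : R) : rnorm (r%:C%C) = `|r|.
Proof. by rewrite /rnorm normc_def/= expr0n addr0 sqrtr_sqr. Qed.

Lemma rnorm_Re z : `|complex.Re z| <= rnorm z.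
Proof. by rewrite -lecR -rnormE normc_ge_Re. Qed.

Lemma rnorm_i : rnorm ('i%C : R[i]) = 1.
Proof. by rewrite /rnorm normc_def/= expr0n expr1n add0r sqrtr1. Qed.

Lemma rnorm_Im z : `|complex.Im z| <= rnorm z.
Proof.
have := rnorm_Re (z * 'i%C); rewrite rnormM rnorm_i mulr1.
by case: z => a b /=; rewrite mulr0 mulr1 sub0r normrN.
Qed.

Lemma rnorm_le_ReIm z : rnorm z <= `|complex.Re z| + `|complex.Im z|.
Proof.
rewrite [X in rnorm X]complexE (le_trans (rnormD _ _))// rnormM rnorm_i mul1r.
by rewrite !rnormC.
Qed.

Lemma rnorm_conj z : rnorm z^* = rnorm z.
Proof. by rewrite /rnorm norm_conjC. Qed.

Lemma rnorm_int (m : int) : rnorm (m%:~R : R[i]) = `|m%:~R : R|.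
Proof. by rewrite -rnormC rmorph_int. Qed.

Lemma rnormZ (V : normedModType R[i]) z (x : V) : rnorm (z *: x) = rnorm z * rnorm x.
Proof. by apply: (@complexI R); rewrite rcE -!rnormE normrZ. Qed.

End RealNormScalar.

Definition rdot (R : realType) (V : hilbertType R) (x y : V) : R :=
  complex.Re (hdot x y).

Section RealDot.
Variables (R : realType) (V : hilbertType R).
Implicit Types (x y z : V) (r : R).

Lemma hdotDl x y z : hdot (x + y) z = hdot x z + hdot y z.
Proof. by rewrite linearDl. Qed.

Lemma hdotBl x y z : hdot (x - y) z = hdot x z - hdot y z.
Proof. by rewrite linearBl. Qed.

Lemma hdotC x y : hdot x y = (hdot y x)^*.
Proof. by rewrite hermC expr0 mul1r. Qed.

Lemma rdotC x y : rdot x y = rdot y x.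
Proof. by rewrite /rdot hdotC; case: (hdot y x). Qed.

Lemma rdotDl x y z : rdot (x + y) z = rdot x z + rdot y z.
Proof. by rewrite /rdot hdotDl raddfD. Qed.

Lemma rdotBl x y z : rdot (x - y) z = rdot x z - rdot y z.
Proof. by rewrite /rdot hdotBl raddfB. Qed.

Lemma rdotBr x y z : rdot x (y - z) = rdot x y - rdot x z.
Proof. by rewrite !(rdotC x) rdotBl. Qed.

Lemma rdotZl r x y : rdot (r%:C%C *: x) y = r * rdot x y.
Proof. by rewrite /rdot hdotZl; case: (hdot x y) => a b /=; rewrite mul0r subr0. Qed.

Lemma rdotxx x : rdot x x = rnorm x ^+ 2.
Proof. by apply: (@complexI R); rewrite /rdot hdotE rnormE -rmorphXn. Qed.

Lemma hdotxx x : hdot x x = (rnorm x ^+ 2)%:C%C.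
Proof. by rewrite hdotE rnormE -rmorphXn. Qed.

Lemma rnorm_hdot x y : rnorm (hdot x y) <= rnorm x * rnorm y.
Proof.
by rewrite -lecR rcE -!rnormE [`|x|]hilbert_normE [`|y|]hilbert_normE dot_CauchySchwarz.
Qed.

Lemma rdot_le x y : `|rdot x y| <= rnorm x * rnorm y.
Proof. exact: le_trans (rnorm_Re _) (rnorm_hdot _ _). Qed.

Lemma sqrB x y : rnorm (x - y) ^+ 2 = rnorm x ^+ 2 - 2 * rdot x y + rnorm y ^+ 2.
Proof. by rewrite -!rdotxx !(rdotBl, rdotBr) (rdotC y x); ring. Qed.

Lemma sqrD x y : rnorm (x + y) ^+ 2 = rnorm x ^+ 2 + 2 * rdot x y + rnorm y ^+ 2.
Proof. by rewrite -!rdotxx rdotDl !(rdotC _ (x + y)) !rdotDl (rdotC y x); ring. Qed.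

Lemma rdot_i x y : rdot x ('i%C *: y) = complex.Im (hdot x y).
Proof. by rewrite /rdot hdotZr; case: (hdot x y) => a b /=; ring. Qed.

End RealDot.

Section RealSequences.
Variables (R : realType).

Lemma small_inv (e : R) : 0 < e -> exists N, forall n, (N <= n)%N -> n.+1%:R^-1 < e.
Proof.
move=> e0; exists (Num.truncn e^-1) => n Nn.
rewrite -[ltRHS]invrK ltf_pV2 ?posrE ?invr_gt0//.
by rewrite (lt_le_trans (truncnS_gt _))// ler_nat ltnS.
Qed.

Lemma small_exp2 (e : R) : 0 < e -> exists N, forall n, (N <= n)%N -> 2^-1 ^+ n < e.
Proof.
move=> /small_inv[N Ne]; exists N => n /Ne; apply: le_lt_trans.
rewrite exprVn lef_pV2 ?posrE ?exprn_gt0// -natrX ler_nat.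
exact: ltn_expl.
Qed.

Lemma le_eps (a b : R) : (forall e, 0 < e -> a <= b + e) -> a <= b.
Proof. by move=> ab; apply/ler_addgt0Pr => e /ab. Qed.

End RealSequences.

Section Complete.
Variables (R : realType) (V : completeNormedModType R[i]).

Lemma rnorm_complete (u : nat -> V) :
  (forall e : R, 0 < e -> exists N, forall m n, (N <= m)%N -> (N <= n)%N ->
     rnorm (u m - u n) < e) ->
  exists l, forall e : R, 0 < e -> exists N, forall n, (N <= n)%N ->
     rnorm (u n - l) < e.
Proof.
move=> uc.
have : cvg (u @ \oo).
  apply: cauchy_cvg; apply/cauchyP => e e0.
  have e0' : (complex.Re e)%:C%C = e by rewrite rcReE// ltW.
  have [|N Nu] := uc (complex.Re e); first by rewrite -ltcR e0'.
  exists (u N); exists N => // n /= Nn.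
  by rewrite -ball_normE/= rnormE -e0' ltcR Nu.
move=> /cvg_ex[l ul]; exists l => e e0.
have e0' : 0 < e%:C%C by rewrite ltcR.
move/cvgrPdist_lt: ul => /(_ _ e0')[N _ Nu]; exists N => n Nn.
by rewrite -ltcR -rnormE distrC; exact: Nu.
Qed.

End Complete.

(** * Orthogonal projection and weak cluster points *)

Section Riesz.
Variables (R : realType) (V : hilbertType R).

Definition norm_closed (E : set V) :=
  forall x, (forall e : R, 0 < e -> exists2 y, E y & rnorm (y - x) < e) -> E x.

(** A sequence in E minimizing |x|^2 - 2 L x is Cauchy by the parallelogram identity,
    and optimality of its limit is the stated equation.  When E is everything this is the
    Riesz representation theorem; when L is the inner product with a fixed vector, y is the
    orthogonal projection of that vector onto E. *)
Lemma riesz_on (E : set V) (L : V -> R) (C : R) :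
  E 0 -> (forall x y, E x -> E y -> E (x + y)) ->
  (forall (r : R) x, E x -> E (r%:C%C *: x)) -> norm_closed E ->
  (forall x y, L (x + y) = L x + L y) ->
  (forall (r : R) x, L (r%:C%C *: x) = r * L x) ->
  (forall x, `|L x| <= C * rnorm x) ->
  exists2 y, E y & forall z, E z -> rdot y z = L z.
Proof.
move=> E0 ED EZ Ecl LD LZ LC.
pose J x := rnorm x ^+ 2 - 2 * L x.
pose S := [set J x | x in E].
have infS : has_inf S.
  split; first by exists (J 0), 0.
  exists (- C ^+ 2) => _ [x Ex <-]; rewrite /J.
  have := LC x; rewrite ler_norml => /andP[_ Lx].
  have := sqr_ge0 (rnorm x - C); rewrite sqrrB mulr2n; nra.
set m := inf S.
have mJ x : E x -> m <= J x by move=> Ex; apply: ge_inf; [case: infS|exists x].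
have apx n : exists x, E x /\ J x < m + n.+1%:R^-1.
  have [|_ [x Ex <-] Jx] := @inf_adherent R S n.+1%:R^-1 _ infS.
    by rewrite invr_gt0.
  by exists x.
have [u uP] := choice apx.
have uE n : E (u n) by have [] := uP n.
have uJ n : J (u n) <= m + n.+1%:R^-1 by apply/ltW; have [] := uP n.
(* Optimality at the approximate minimizers, tested along a line. *)
have opt n z : E z -> (rdot (u n) z - L z) ^+ 2 <= n.+1%:R^-1 * rnorm z ^+ 2.
  move=> Ez; set b := rdot (u n) z - L z.
  have H t : 0 <= t ^+ 2 * rnorm z ^+ 2 + 2 * t * b + n.+1%:R^-1.
    have := mJ _ (ED _ _ (uE n) (EZ t _ Ez)).
    rewrite /J sqrD LD LZ (rdotC (u n)) rdotZl (rdotC z) rnormZ rnormC exprMn.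
    rewrite real_normK ?num_real// => H1.
    have H2 := uJ n; rewrite /J in H2; rewrite /b.
    move: H1 H2; move: (rnorm _) (rnorm _) (rdot _ _) (L _) (L _) => p q d l1 l2.
    by move: (m) (_^-1) => m1 k; nra.
  have [z0|z0] := eqVneq (rnorm z) 0.
    rewrite z0 expr0n mulr0.
    have -> : b = 0; last by rewrite expr0n.
    have := le_trans (rdot_le (u n) z) _; rewrite z0 mulr0 => /(_ _ (lexx _)).
    rewrite normr_le0 => /eqP d0.
    have := LC z; rewrite z0 mulr0 normr_le0 => /eqP L0.
    by rewrite /b d0 L0 subr0.
  have zp : 0 < rnorm z ^+ 2 by rewrite exprn_gt0// lt_neqAle rnorm_ge0 eq_sym z0.
  (* The minimum of the quadratic polynomial in t. *)
  have := H (- b / rnorm z ^+ 2).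
  have -> : (- b / rnorm z ^+ 2) ^+ 2 * rnorm z ^+ 2 + 2 * (- b / rnorm z ^+ 2) * b + n.+1%:R^-1
    = n.+1%:R^-1 - b ^+ 2 / rnorm z ^+ 2.
    by move: (n.+1%:R^-1) => k; field; rewrite z0.
  by rewrite subr_ge0 ler_pdivrMr.
have [|y uy] := @rnorm_complete R V u.
  move=> e e0.
  have [|N Ne] := @small_inv R (e ^+ 2 / 4); first by rewrite divr_gt0 ?exprn_gt0.
  exists N => i j /Ne iN /Ne jN.
  rewrite -(ltr_pXn2r (n := 2)) ?nnegrE ?rnorm_ge0 ?ltW//.
  have := mJ _ (EZ 2^-1 _ (ED _ _ (uE i) (uE j))).
  have := uJ i; have := uJ j; rewrite /J LZ LD rnormZ rnormC exprMn.
  rewrite sqrD sqrB real_normK ?num_real//.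
  set a := _^-1 in iN *; set b := _^-1 in jN *; nra.
exists y.
  apply: Ecl => e /uy[N uN]; exists (u N) => //; exact: uN.
move=> z Ez; apply/eqP; rewrite -subr_eq0 -normr_le0; apply: le_eps => e e0.
rewrite add0r.
have [|N1 H1] := uy (e / 2 / (rnorm z + 1)).
  by rewrite divr_gt0 ?divr_gt0// ltr_wpDl ?rnorm_ge0.
have [|N2 H2] := @small_inv R ((e / 2 / (rnorm z + 1)) ^+ 2).
  by rewrite exprn_gt0// divr_gt0 ?divr_gt0// ltr_wpDl ?rnorm_ge0.
set n := maxn N1 N2.
have {}H1 := H1 n (leq_maxl _ _); have {}H2 := H2 n (leq_maxr _ _).
set d := e / 2 / (rnorm z + 1) in H1 H2.
have zp : 0 < rnorm z + 1 by rewrite ltr_wpDl ?rnorm_ge0.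
have d0 : 0 < d by rewrite divr_gt0 ?divr_gt0.
have dz : d * rnorm z <= e / 2.
  by rewrite -mulrA ler_piMr ?ler_pdivrMl// ?mulr1 ?lerDl ?divr_ge0 ?ltW.
have -> : rdot y z - L z = (rdot (u n) z - L z) - rdot (u n - y) z.
  by rewrite rdotBl; ring.
clearbody d.
rewrite (le_trans (ler_normB _ _))// [leRHS]splitr lerD//.
  apply: le_trans dz.
  rewrite -(ler_pXn2r (n := 2)) ?nnegrE ?mulr_ge0 ?rnorm_ge0 ?(ltW d0)//.
  rewrite real_normK ?num_real// exprMn (le_trans (opt _ _ Ez))//.
  by rewrite ler_wpM2r ?sqr_ge0// ltW.
rewrite (le_trans (rdot_le _ _))// (le_trans _ dz)//.
by rewrite ler_wpM2r ?rnorm_ge0// ltW.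
Qed.

End Riesz.

Section WeakCluster.
Variables (R : realType) (V : hilbertType R).

Lemma bounded_ultralim (U : set_system nat) (FU : UltraFilter U) (a : nat -> R) (M : R) :
  (forall n, `|a n| <= M) -> cvg (a @ U).
Proof.
move=> aM; have PU : ProperFilter U by exact: ultra_proper.
have UM : (a @ U) `[- M, M]%classic.
  by apply: (@filterE _ U) => n; rewrite /= in_itv/= -ler_norml; exact: aM.
have [p [_ ap]] := @segment_compact R (- M) M (a @ U) _ UM.
apply/cvg_ex; exists p => B pB.
have [//|UB] := in_ultra_setVsetC (a @^-1` B) FU.
by have [x [/= nBx Bx]] := ap (~` B) B UB pB.
Qed.

(** A substitute for weak compactness of balls: y represents the limit, along a free
    ultrafilter, of the functionals given by the v n. *)
Lemma weak_cluster (v : nat -> V) (M : R) : (forall n, rnorm (v n) <= M) ->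
  exists y, forall z (e : R) N, 0 < e ->
    exists2 n, (N <= n)%N & rnorm (hdot (v n - y) z) < e.
Proof.
move=> vM.
(* An ultrafilter finer than the Frechet filter: its limits are cluster values. *)
have [U [FU UN]] := @ultraFilterLemma _ (\oo : set_system nat) _.
have PU : ProperFilter U by exact: ultra_proper.
have bnd z n : `|rdot (v n) z| <= M * rnorm z.
  by rewrite (le_trans (rdot_le _ _))// ler_wpM2r ?rnorm_ge0.
have cv z := bounded_ultralim FU (bnd z).
pose L z := lim ((fun n => rdot (v n) z) @ U).
have LP z : (fun n => rdot (v n) z) @ U --> L z by exact: cv.
have uniq (f : nat -> R) (a b : R) : f @ U --> a -> f @ U --> b -> a = b.
  by move=> fa fb; exact: (cvg_unique (@Rhausdorff R) fa fb).
have [| | | | | | | y _ yL] := @riesz_on R V setT L M => //.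
- move=> x y; apply: (uniq _ _ _ (LP _)).
  under eq_fun do rewrite rdotC rdotDl !(rdotC _ (v _)).
  exact: cvgD (LP x) (LP y).
- move=> r x; apply: (uniq _ _ _ (LP _)).
  under eq_fun do rewrite rdotC rdotZl !(rdotC _ (v _)).
  by apply: cvgM (LP x); exact: cvg_cst.
- move=> x; apply: (@closed_cvg _ _ U _ (fun n => `|rdot (v n) x|) [set r | r <= M * rnorm x]).
  + exact: closed_le.
  + by apply: filterE => n /=; exact: bnd.
  + exact: cvg_norm (LP x).
exists y => z e N e0.
have e2 : 0 < e / 2 by rewrite divr_gt0.
have near w : U [set n | `|rdot (v n - y) w| < e / 2].
  move/cvgrPdist_lt: (LP w) => /(_ _ e2).
  by apply: filterS => n; rewrite -yL// distrC -rdotBl.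
have UNN : U [set n | (N <= n)%N] by apply: UN; exists N.
have [n /= [[n1 n2] n3]] := filter_ex (filterI (filterI (near z) (near ('i%C *: z))) UNN).
exists n => //.
rewrite rdot_i in n2; rewrite (le_lt_trans (rnorm_le_ReIm _))// [ltRHS]splitr.
exact: ltrD.
Qed.

End WeakCluster.

(** * Functions whose level sets lie in the coset ring *)

Section CosetRing.
Variables (R : realType) (H : lcGroupType).
Implicit Types (X Y : set H) (f g : H -> R[i]).

Lemma Omega_setT : Omega H setT.
Proof.
apply: sub_setring; exists setT, 1%g; split; [by split|exact: openT|].
by apply/seteqP; split => h // _; exists h => //; rewrite mul1g.
Qed.

Lemma Omega_setI X Y : Omega H X -> Omega H Y -> Omega H (X `&` Y).
Proof. by move=> oX oY; rewrite -setDD; do 2?apply: setringD. Qed.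

Definition level_sets_in_ring f := forall c, Omega H [set h | f h = c].

(** Being absorbed by addition is stable under finite sums, while level sets in the ring
    may be lost in the sum of two functions of infinite range. *)
Definition ring_simple f :=
  forall g, level_sets_in_ring g -> level_sets_in_ring (fun h => f h + g h).

Lemma level_sets_cst c : level_sets_in_ring (fun=> c).
Proof.
move=> d; have [->|cd] := eqVneq c d.
  by rewrite (_ : mkset _ = setT) ?predeqE//; exact: Omega_setT.
rewrite (_ : mkset _ = set0); first exact: setring0.
by rewrite predeqE => h; split=> // /eqP; rewrite (negbTE cd).
Qed.

Lemma ring_simple_level_sets f : ring_simple f -> level_sets_in_ring f.
Proof.
move=> /(_ _ (level_sets_cst 0)).
by congr (level_sets_in_ring _); apply/funext => h; rewrite addr0.
Qed.

Lemma ring_simpleD f g : ring_simple f -> ring_simple g ->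
  ring_simple (fun h => f h + g h).
Proof.
move=> sf sg k /sg/sf; congr (level_sets_in_ring _).
by apply/funext => h; rewrite addrA.
Qed.

Lemma ring_simple0 : ring_simple (fun=> 0).
Proof. by move=> g; congr (level_sets_in_ring _); apply/funext => h; rewrite add0r. Qed.

Lemma ring_simple_indic c (P : pred H) : Omega H [set h | P h] ->
  ring_simple (fun h => c * (P h)%:R).
Proof.
move=> oP g sg d.
have -> : [set h | c * (P h)%:R + g h = d] =
    ([set h | P h] `&` [set h | g h = d - c]) `|` ([set h | g h = d] `\` [set h | P h]).
  rewrite predeqE => h /=; split.
    case: (P h); rewrite (mulr1, mulr0); last by rewrite add0r; right.
    by move=> <-; left; split=> //; rewrite addrAC subrr add0r.
  move=> [[-> ->]|[-> /negP/negbTE ->]]; last by rewrite mulr0 add0r.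
  by rewrite mulr1 addrC subrK.
apply: setringU; first by apply: Omega_setI => //; exact: sg.
by apply: setringD => //; exact: sg.
Qed.

Lemma ring_simple_sum (I : Type) (r : seq I) (F : I -> H -> R[i]) :
  (forall i, ring_simple (F i)) -> ring_simple (fun h => \sum_(i <- r) F i h).
Proof.
move=> sF; elim: r => [|i r ih].
  by under eq_fun do rewrite big_nil; exact: ring_simple0.
by under eq_fun do rewrite big_cons; exact: ring_simpleD.
Qed.

End CosetRing.

(** * Integral vectors and the idempotent theorem *)

Section Integers.
Variable R : realType.

Definition is_int (z : R[i]) := exists m : int, z = m%:~R.

Lemma int_small (z : R[i]) : is_int z -> rnorm z < 1 -> z = 0.
Proof.
move=> [m ->]; rewrite rnorm_int -intr_norm ltrz1 => m1.
by case: m m1 => [[|n]|n].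
Qed.

Lemma is_intB z w : is_int z -> is_int w -> is_int (z - w).
Proof. by move=> [m ->] [n ->]; exists (m - n); rewrite rmorphB. Qed.

Lemma is_int_closed (z : R[i]) :
  (forall e : R, 0 < e -> exists2 w, is_int w & rnorm (w - z) < e) -> is_int z.
Proof.
move=> zint.
have [|w wint wz] := zint 2^-1; first by rewrite invr_gt0.
suff -> : z = w by [].
apply/eqP; rewrite eq_sym -subr_eq0 -rnorm_eq0 eq_le rnorm_ge0 andbT.
apply: le_eps => e e0; rewrite add0r.
have [|v vint] := zint (Num.min e 2^-1); first by rewrite lt_min e0 invr_gt0 ltr0n.
rewrite lt_min => /andP[ve v2]; suff -> : w = v by exact: ltW.
apply/eqP; rewrite -subr_eq0; apply/eqP/int_small; first exact: is_intB.
rewrite -(subrKA z) (le_lt_trans (rnormD _ _))// (rnormB z) [ltRHS]splitr mul1r.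
exact: ltrD.
Qed.

End Integers.

Lemma finite_pos_lb (R : realType) (T : choiceType) (F : set T) (f : T -> R) :
  finite_set F -> (forall v, F v -> 0 < f v) ->
  exists2 e : R, 0 < e & forall v, F v -> e <= f v.
Proof.
move=> /finite_seqP[s ->]; elim: s => [|v s ih] fp; first by exists 1.
have [|e e0 es] := ih; first by move=> w ws; apply: fp; rewrite /= inE; apply/orP; right.
have fv : 0 < f v by apply: fp; rewrite /= inE eqxx.
exists (Num.min e (f v)); first by rewrite lt_min e0.
move=> w; rewrite /= inE => /orP[/eqP ->|ws]; first by rewrite ge_min lexx orbT.
by rewrite ge_min es.
Qed.

Section IntegralVectors.
Variables (R : realType) (H : lcGroupType) (sigma : urep R H) (eta : sigma).
Local Notation act := (urep_act sigma).
Implicit Types (x y z v : sigma) (s t : H).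

Lemma actK s x : act s^-1%g (act s x) = x.
Proof. by rewrite -urep_actM mulVg urep_act1. Qed.

Lemma act_adj s x y : hdot (act s x) y = hdot x (act s^-1%g y).
Proof. by rewrite -[in RHS](urep_act_dot s) -urep_actM mulgV urep_act1. Qed.

Lemma act_rnorm s x : rnorm (act s x) = rnorm x.
Proof. by rewrite /rnorm urep_act_norm. Qed.

(** The orthogonal complement of the cyclic subspace generated by eta. *)
Definition perp z := forall t, hdot (act t z) eta = 0.

(** The first clause puts x in the closed cyclic subspace generated by eta, so that x is
    determined by its coefficient function against eta. *)
Definition integral_vec x :=
  (forall z, perp z -> hdot x z = 0) /\ forall t, is_int (hdot (act t x) eta).

(** Distinct integral vectors are at least this far apart; the summand 1 allows
    eta = 0. *)
Definition gap : R := (rnorm eta + 1)^-1.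

Lemma gap_gt0 : 0 < gap.
Proof. by rewrite invr_gt0 ltr_wpDl ?rnorm_ge0. Qed.

Lemma perp_act s z : perp z -> perp (act s z).
Proof. by move=> pz t; rewrite -urep_actM. Qed.

Lemma integral_act s x : integral_vec x -> integral_vec (act s x).
Proof.
move=> [cx ix]; split; first by move=> z /(perp_act s^-1%g)/cx; rewrite act_adj.
by move=> t; rewrite -urep_actM.
Qed.

Lemma integralB x y : integral_vec x -> integral_vec y -> integral_vec (x - y).
Proof.
move=> [cx ix] [cy iy]; split; first by move=> z pz; rewrite hdotBl cx// cy// subrr.
by move=> t; rewrite linearB/= hdotBl; exact: is_intB.
Qed.

(** The coefficient of such an x is integral and smaller than 1 in modulus, hence 0;
    then x is orthogonal to the cyclic subspace, to which it belongs. *)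
Lemma integral_small x : integral_vec x -> rnorm x < gap -> x = 0.
Proof.
move=> [cx ix] xg; have px : perp x.
  move=> t; apply: int_small => //; rewrite (le_lt_trans (rnorm_hdot _ _))// act_rnorm.
  rewrite (@le_lt_trans _ _ (rnorm x * (rnorm eta + 1)))//.
    by rewrite ler_wpM2l ?rnorm_ge0// lerDl.
  by rewrite -ltr_pdivlMr ?mul1r// ltr_wpDl ?rnorm_ge0.
have /eqP := cx _ px; rewrite hdotxx => /eqP[/eqP].
by rewrite sqrf_eq0 rnorm_eq0 => /eqP.
Qed.

Lemma integral_gap x : integral_vec x -> x != 0 -> gap <= rnorm x.
Proof. by move=> ix; apply: contraNle => xg; rewrite (integral_small ix xg). Qed.

(** Membership of y in the weak closure of the orbit of x, except that the orbit point
    is only asked to work for one test vector at a time.  This weaker relation is still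
    transitive, because the action is unitary, and it still preserves integrality. *)
Definition weak_limit x y := forall z (e : R), 0 < e ->
  exists s, rnorm (hdot (act s x - y) z) < e.

Lemma weak_limit_refl x : weak_limit x x.
Proof. by move=> z e e0; exists 1%g; rewrite urep_act1 subrr linear0l rnorm0. Qed.

Lemma weak_limit_trans x y z : weak_limit x y -> weak_limit y z -> weak_limit x z.
Proof.
move=> xy yz w e e0.
have e2 : 0 < e / 2 by rewrite divr_gt0.
have [s sP] := yz w _ e2; have [t tP] := xy (act s^-1%g w) _ e2.
exists (s * t)%g; rewrite urep_actM -(subrKA (act s y)) -linearB hdotDl.
by rewrite (le_lt_trans (rnormD _ _))// [ltRHS]splitr ltrD// act_adj.
Qed.

Lemma integral_weak_limit x y : integral_vec x -> weak_limit x y -> integral_vec y.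
Proof.
move=> ix xy; split=> [z pz|t].
  apply/eqP; rewrite -rnorm_eq0 eq_le rnorm_ge0 andbT; apply: le_eps => e e0.
  have [s] := xy z _ e0; have [+ _] := integral_act s ix.
  by rewrite hdotBl => -> //; rewrite sub0r rnormN add0r => /ltW.
apply: is_int_closed => e e0; rewrite act_adj.
have [s] := xy (act t^-1%g eta) _ e0; rewrite hdotBl => sP.
exists (hdot (act s x) (act t^-1%g eta)) => //.
by rewrite -act_adj; have [_] := integral_act s ix; apply.
Qed.

(** The orbit of y has no weak accumulation point other than 0. *)
Definition vanishing_orbit y := forall z (d : R), 0 < d ->
  finite_set [set v | (exists s, v = act s y) /\ d <= rnorm (hdot v z)].

Lemma vanishing_orbit_act s y : vanishing_orbit y -> vanishing_orbit (act s y).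
Proof.
move=> vy z d /(vy z); apply: sub_finite_set => v [[t ->] td]; split=> //.
by exists (t * s)%g; rewrite urep_actM.
Qed.

(** Distinct points v of the orbit of y satisfy
    Re <v, v'> = |y|^2 - |v - v'|^2 / 2 <= |y|^2 - gap^2 / 2, and this bound passes to a weak
    cluster point y' in both arguments, one after the other.  Taking the points where
    |<v, z>| >= d keeps y' away from 0. *)
Lemma norm_drop y : integral_vec y -> ~ vanishing_orbit y -> exists y',
  [/\ y' != 0, weak_limit y y' & rnorm y' ^+ 2 <= rnorm y ^+ 2 - gap ^+ 2 / 2].
Proof.
move=> iy; rewrite /vanishing_orbit -existsNE => -[z].
rewrite -existsNE => -[d]; rewrite not_implyE => -[d0 infF].
have /infiniteP/pcard_leP/injfunPex[v vS vinj] := infF.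
have vact n : exists s, v n = act s y by have [] := vS n I.
have vd n : d <= rnorm (hdot (v n) z) by have [] := vS n I.
have iv n : integral_vec (v n) by have [s ->] := vact n; exact: integral_act.
have nv n : rnorm (v n) = rnorm y by have [s ->] := vact n; exact: act_rnorm.
have sep m n : m != n -> rdot (v m) (v n) <= rnorm y ^+ 2 - gap ^+ 2 / 2.
  move=> mn; have := @integral_gap (v m - v n) (integralB (iv _) (iv _)).
  rewrite subr_eq0 => gmn.
  have {gmn} g : gap <= rnorm (v m - v n).
    by apply: gmn; apply: contra_neq mn => /vinj -> //; rewrite inE.
  have : gap ^+ 2 <= rnorm (v m - v n) ^+ 2.
    by rewrite ler_pXn2r// nnegrE ?rnorm_ge0 ?ltW ?gap_gt0.
  by rewrite sqrB !nv => g2; lra.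
have [|y' y'P] := @weak_cluster _ _ v (rnorm y); first by move=> n; rewrite nv.
exists y'; split.
- apply/negP => /eqP y'0; have [n _] := y'P z d 0%N d0.
  by rewrite y'0 subr0 ltNge vd.
- move=> w e e0; have [n _] := y'P w e 0%N e0; have [s ->] := vact n.
  by exists s.
rewrite -rdotxx; apply: le_eps => e e0.
have e2 : 0 < e / 2 by rewrite divr_gt0.
(* First n with v n close to y' against y', then m > n with v m close to y' against v n. *)
have [n _ n1] := y'P y' _ 0%N e2; have [m nm m1] := y'P (v n) _ n.+1 e2.
have {nm} mn : m != n by rewrite gtn_eqF.
have := le_lt_trans (rnorm_Re _) n1; have := le_lt_trans (rnorm_Re _) m1.
rewrite -/(rdot _ _) -/(rdot _ _) !rdotBl (rdotC y' (v n)) !ltr_norml => /andP[h1 _] /andP[h2 _].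
have := sep _ _ mn; lra.
Qed.

(** A nonzero weak limit y whose squared norm is within gap^2 / 2 of the infimum will do:
    otherwise the norm drop leads below the infimum. *)
Lemma vanishing_limit x : integral_vec x -> x != 0 -> exists y,
  [/\ y != 0, weak_limit x y & vanishing_orbit y].
Proof.
move=> ix x0.
pose S := [set rnorm y ^+ 2 | y in [set y | y != 0 /\ weak_limit x y]].
have infS : has_inf S.
  split; last by exists 0 => _ [y _ <-]; exact: sqr_ge0.
  by exists (rnorm x ^+ 2), x => //; split=> //; exact: weak_limit_refl.
have g0 : 0 < gap ^+ 2 / 2 by rewrite divr_gt0 ?exprn_gt0 ?gap_gt0.
have [_ [y [y0 xy] <-] yS] := inf_adherent g0 infS.
exists y; split=> //; apply: contrapT => vy.
have [y' [y'0 yy' le]] := norm_drop (integral_weak_limit ix xy) vy.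
have : inf S <= rnorm y' ^+ 2.
  apply: ge_inf; first by case: infS.
  by exists y' => //; split=> //; exact: weak_limit_trans yy'.
lra.
Qed.

(** Let y be a nonzero weak limit of the orbit of x with vanishing orbit.  The number
    |y|^2 is a limit of values <s x, y> = <x, s^-1 y>.  But these are the inner products of x
    with the orbit of y, which accumulate only at 0, so |y|^2 is attained, and v = s^-1 y is
    orthogonal to x - v. *)
Lemma split_vanishing x : integral_vec x -> x != 0 -> exists v,
  [/\ v != 0, integral_vec v, vanishing_orbit v &
      rnorm (x - v) ^+ 2 = rnorm x ^+ 2 - rnorm v ^+ 2].
Proof.
move=> ix x0; have [y [y0 xy vy]] := vanishing_limit ix x0.
have iy := integral_weak_limit ix xy.
suff [s sP] : exists s, rdot x (act s y) = rnorm y ^+ 2.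
  exists (act s y); split.
  - by rewrite -rnorm_eq0 act_rnorm rnorm_eq0.
  - exact: integral_act.
  - exact: vanishing_orbit_act.
  - by rewrite sqrB sP act_rnorm; ring.
apply: contrapT => /forallNP ns.
set N := rnorm y ^+ 2.
have N0 : 0 < N by rewrite exprn_gt0// rnorm_gt0.
have N2 : 0 < N / 2 by rewrite divr_gt0.
have [|e e0 eP] := finite_pos_lb (f := fun v => `|rdot x v - N|) (vy x _ N2).
  by move=> v [[s ->] _]; rewrite normr_gt0 subr_eq0; apply/eqP; exact: ns.
have [|s sP] := xy y (Num.min e (N / 2)); first by rewrite lt_min e0.
have := le_lt_trans (rnorm_Re _) sP; rewrite -/(rdot _ _) rdotBl rdotxx -/N.
have -> : rdot (act s x) y = rdot x (act s^-1%g y) by rewrite /rdot act_adj.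
rewrite lt_min => /andP[le lN].
suff : e <= `|rdot x (act s^-1%g y) - N| by rewrite leNgt le.
apply: eP; split; first by exists s^-1%g.
apply: le_trans (rnorm_Re _); rewrite -/(rdot _ _) rdotC.
move: lN; rewrite ltr_norml => /andP[l1 _]; apply: le_trans (ler_norm _); lra.
Qed.

(** A nonempty fiber is a coset of the stabilizer of y, which is open because orbit
    points closer than gap to y are equal to y. *)
Lemma orbit_fiber_Omega y v : integral_vec y -> Omega H [set s | act s y == v].
Proof.
move=> iy; have [[a <-]|nv] := pselect (exists a, act a y = v); last first.
  rewrite (_ : mkset _ = set0); first exact: setring0.
  by rewrite -subset0 => s /= /eqP sv; apply: nv; exists s.
apply: sub_setring; exists [set s | act s y = y], a; split.
- split; first by rewrite /= urep_act1.
    by move=> s t /= sy ty; rewrite urep_actM ty.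
  by move=> s /= sy; rewrite -{1}sy actK.
- rewrite openE => s /= sy.
  have g0 : 0 < gap%:C%C by rewrite ltcR gap_gt0.
  have /cvgrPdist_lt/(_ _ g0) := @urep_act_continuous _ _ sigma y s.
  apply: filterS => t; rewrite sy rnormE ltcR => yt.
  have /eqP := integral_small (integralB iy (integral_act t iy)) yt.
  by rewrite subr_eq0 => /eqP.
- apply/seteqP; split=> [s /= /eqP sa|_ [s /= sy <-]].
    exists (a^-1 * s)%g; last by rewrite mulVKg.
    by rewrite urep_actM sa actK.
  by rewrite urep_actM sy.
Qed.


(** An integral coefficient is nonzero only where it has modulus at least 1, which happens
    at finitely many points v of the orbit; so it is a finite combination of indicator
    functions of fibers of the orbit map. *)
Lemma vanishing_simple y : integral_vec y -> vanishing_orbit y ->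
  ring_simple (coef y eta).
Proof.
move=> iy vy; have /finite_seqP[r rE] := vy eta 1 ltr01.
pose vs := undup r.
have vsP v : v \in vs <-> (exists s, v = act s y) /\ 1 <= rnorm (hdot v eta).
  by rewrite mem_undup -[is_true _]/([set` r] v) -rE.
have -> : coef y eta = fun s => \sum_(v <- vs) hdot v eta * (act s y == v)%:R.
  apply/funext => s; rewrite /coef.
  have [sv|/negP sv] := boolP (act s y \in vs).
    rewrite (bigD1_seq (act s y)) ?undup_uniq//= eqxx mulr1 big1 ?addr0// => v vs'.
    by rewrite eq_sym (negbTE vs') mulr0.
  rewrite big_seq big1.
    have [_ /(_ s) iys] := iy; apply: int_small => //; rewrite ltNge; apply/negP => le.
    by apply: sv; apply/vsP; split=> //; exists s.
  by move=> v vv; case: eqP => [sE|_]; [rewrite sE vv in sv|rewrite mulr0].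
by apply: ring_simple_sum => v; apply: ring_simple_indic; exact: orbit_fiber_Omega.
Qed.

(** Each splitting lowers the squared norm by at least gap^2, so finitely many of them
    exhaust x. *)
Lemma integral_simple x : integral_vec x -> ring_simple (coef x eta).
Proof.
move=> ix; have [n] : exists n : nat, rnorm x ^+ 2 < n%:R * gap ^+ 2.
  have g0 : 0 < gap ^+ 2 by rewrite exprn_gt0 ?gap_gt0.
  exists (Num.truncn (rnorm x ^+ 2 / gap ^+ 2)).+1.
  by rewrite -ltr_pdivrMr// truncnS_gt.
elim: n x ix => [|n ih] x ix.
  by rewrite mul0r ltNge sqr_ge0.
move=> xn; have [->|x0] := eqVneq x 0.
  rewrite (_ : coef 0 eta = fun=> 0); first exact: ring_simple0.
  by apply/funext => s; rewrite /coef linear0 linear0l.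
have [v [v0 iv vv xvE]] := split_vanishing ix x0.
have -> : coef x eta = fun h => coef v eta h + coef (x - v) eta h.
  by apply/funext => s; rewrite /coef -hdotDl -linearD/= addrC subrK.
apply: ring_simpleD; first exact: vanishing_simple.
apply: ih; first exact: integralB.
have : gap ^+ 2 <= rnorm v ^+ 2.
  by rewrite ler_pXn2r ?integral_gap// nnegrE ?rnorm_ge0 ?ltW ?gap_gt0.
by move: xn; rewrite xvE -natr1 mulrDl mul1r; lra.
Qed.

Lemma perp_norm_closed : norm_closed perp.
Proof.
move=> x xP t; apply/eqP; rewrite -rnorm_eq0 eq_le rnorm_ge0 andbT.
apply: le_eps => e e0; rewrite add0r.
have e1 : 0 < e * gap by rewrite mulr_gt0 ?gap_gt0.
have [y py] := xP _ e1; rewrite rnormB => yx.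
rewrite -[hdot _ _]subr0 -(py t) -hdotBl -linearB/=.
rewrite (le_trans (rnorm_hdot _ _))// act_rnorm.
rewrite (le_trans (ler_wpM2r (rnorm_ge0 _) (ltW yx)))// -mulrA ler_piMr ?ltW//.
by rewrite /gap mulrC ltr_pdivrMr ?mul1r ?ltrDl// ltr_wpDl ?rnorm_ge0.
Qed.

(** Subtracting from x its orthogonal projection onto the complement of the cyclic
    subspace does not change its coefficient. *)
Lemma cyclic_part x : exists2 x', coef x' eta = coef x eta &
  forall z, perp z -> hdot x' z = 0.
Proof.
have [| | | | | | | p pp pP] := @riesz_on R sigma perp (fun z => rdot x z) (rnorm x).
- by move=> t; rewrite linear0 linear0l.
- by move=> y z py pz t; rewrite linearD/= hdotDl py pz addr0.
- by move=> r y py t; rewrite linearZ/= hdotZl py mulr0.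
- exact: perp_norm_closed.
- by move=> y z; rewrite !(rdotC x) rdotDl.
- by move=> r y; rewrite !(rdotC x) rdotZl.
- by move=> y; exact: rdot_le.
exists (x - p).
  by apply/funext => s; rewrite /coef linearB/= hdotBl pp subr0.
move=> z pz; have re w : perp w -> rdot (x - p) w = 0.
  by move=> pw; rewrite rdotBl pP// subrr.
have := re _ pz; have : perp ('i%C *: z).
  by move=> t; rewrite linearZ/= hdotZl pz mulr0.
move=> /re; rewrite rdot_i /rdot; case: (hdot _ _) => a b /= -> ->.
by [].
Qed.

End IntegralVectors.

(** The idempotent theorem, due to Cohen for abelian groups and to Host in general. *)
Lemma idempotent_Omega (R : realType) (H : lcGroupType) (u : FS R H) :
  (forall h, u h * u h = u h) -> Omega H [set h | u h = 1].
Proof.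
move=> uu; have /fs_predP[sigma [xi [eta uE]]] := fsvalP u.
have [x xE xP] := cyclic_part eta xi.
suff ix : integral_vec eta x.
  by have := ring_simple_level_sets (integral_simple ix) 1; rewrite xE -uE.
split=> // t; rewrite -[hdot _ _]/(coef x eta t) xE -uE.
have /eqP := uu t; rewrite -subr_eq0 -{3}[u t]mulr1 -mulrBr mulf_eq0 subr_eq0.
by move=> /orP[]/eqP ->; [exists 0|exists 1].
Qed.

(** * Square-summable sequences *)

Section ComplexLimits.
Variable R : realType.
Implicit Types (a b : nat -> R[i]) (l : R[i]).

Definition clim a l := forall e : R, 0 < e ->
  exists N, forall n, (N <= n)%N -> rnorm (a n - l) < e.

(** The value 0 is a dummy for sequences without a limit. *)
Definition climit a : R[i] := xget 0 [set l | clim a l].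

Lemma clim_unique a l l' : clim a l -> clim a l' -> l = l'.
Proof.
move=> al al'; apply/eqP; rewrite -subr_eq0 -rnorm_eq0 eq_le rnorm_ge0 andbT.
apply: le_eps => e e0; rewrite add0r; have e2 : 0 < e / 2 by rewrite divr_gt0.
have [N aN] := al _ e2; have [M aM] := al' _ e2; set n := maxn N M.
have h1 := aN n (leq_maxl _ _); have h2 := aM n (leq_maxr _ _).
rewrite -(subrKA (a n)) (le_trans (rnormD _ _))// [leRHS]splitr lerD ?ltW//.
by rewrite rnormB.
Qed.

Lemma climitE a l : clim a l -> climit a = l.
Proof. by move=> al; apply: clim_unique (al); exact: (@xgetPex _ 0 [set l | clim a l] (ex_intro _ l al)). Qed.

Lemma clim_ext a b l : a =1 b -> clim a l -> clim b l.
Proof. by move=> ab al e /al[N aN]; exists N => n; rewrite -ab; exact: aN. Qed.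

Lemma clim_eventually a l N : (forall n, (N <= n)%N -> a n = l) -> clim a l.
Proof. by move=> aN e e0; exists N => n /aN ->; rewrite subrr rnorm0. Qed.

Lemma climD a b l l' : clim a l -> clim b l' -> clim (fun n => a n + b n) (l + l').
Proof.
move=> al bl e e0; have e2 : 0 < e / 2 by rewrite divr_gt0.
have [N aN] := al _ e2; have [M bM] := bl _ e2; exists (maxn N M) => n.
rewrite geq_max => /andP[/aN h1 /bM h2].
by rewrite opprD addrACA (le_lt_trans (rnormD _ _))// [ltRHS]splitr ltrD.
Qed.

Lemma climM k a l : clim a l -> clim (fun n => k * a n) (k * l).
Proof.
move=> al e e0; have k0 : 0 < rnorm k + 1 by rewrite ltr_wpDl ?rnorm_ge0.
have [|N aN] := al (e / (rnorm k + 1)); first by rewrite divr_gt0.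
exists N => n /aN; rewrite ltr_pdivlMr// mulrC => h.
by rewrite -mulrBr rnormM (le_lt_trans _ h)// ler_wpM2r ?rnorm_ge0// lerDl.
Qed.

Lemma clim_conj a l : clim a l -> clim (fun n => (a n)^*) l^*.
Proof. by move=> al e /al[N aN]; exists N => n /aN; rewrite -rmorphB rnorm_conj. Qed.

Lemma real_cauchy (f : nat -> R) :
  (forall e : R, 0 < e -> exists N, forall m n, (N <= m)%N -> (N <= n)%N ->
     `|f m - f n| < e) ->
  exists r, forall e : R, 0 < e -> exists N, forall n, (N <= n)%N -> `|f n - r| < e.
Proof.
move=> fc; have : cvg (f @ \oo).
  apply: cauchy_cvg; apply/cauchyP => e e0; have [N fN] := fc e e0.
  by exists (f N); exists N => // n /= Nn; rewrite -ball_normE/= fN.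
move=> /cvg_ex[l fl]; exists l => e e0.
move/cvgrPdist_lt: fl => /(_ _ e0)[N _ fN]; exists N => n Nn.
by rewrite distrC; exact: fN.
Qed.

Lemma clim_cauchy a :
  (forall e : R, 0 < e -> exists N, forall m n, (N <= m)%N -> (N <= n)%N ->
     rnorm (a m - a n) < e) -> clim a (climit a).
Proof.
move=> ac; suff [l al] : exists l, clim a l by rewrite (climitE al).
have [|p pP] := @real_cauchy (fun n => complex.Re (a n)).
  move=> e /ac[N aN]; exists N => m n Nm Nn; rewrite -raddfB.
  exact: le_lt_trans (rnorm_Re _) (aN m n Nm Nn).
have [|q qP] := @real_cauchy (fun n => complex.Im (a n)).
  move=> e /ac[N aN]; exists N => m n Nm Nn; rewrite -raddfB.
  exact: le_lt_trans (rnorm_Im _) (aN m n Nm Nn).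
exists (p +i* q)%C => e e0; have e2 : 0 < e / 2 by rewrite divr_gt0.
have [N pN] := pP _ e2; have [M qM] := qP _ e2; exists (maxn N M) => n.
rewrite geq_max => /andP[/pN h1 /qM h2].
rewrite (le_lt_trans (rnorm_le_ReIm _))// [ltRHS]splitr ltrD//.
  by rewrite raddfB.
by rewrite raddfB.
Qed.

End ComplexLimits.

Section SquareSums.
Variables (R : realType) (V : nat -> hilbertType R).
Implicit Types x y : forall n, V n.

Definition psum x (n : nat) : R := \sum_(0 <= i < n) rnorm (x i) ^+ 2.

Definition pdot x y (n : nat) : R[i] := \sum_(0 <= i < n) hdot (x i) (y i).

Definition sq_summable x := exists M, forall n, psum x n <= M.

Lemma psum_ge0 x n : 0 <= psum x n.
Proof. by apply: sumr_ge0 => i _; exact: sqr_ge0. Qed.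

Lemma psum_cat x m n : (m <= n)%N ->
  psum x n = psum x m + \sum_(m <= i < n) rnorm (x i) ^+ 2.
Proof. by move=> mn; rewrite /psum (@big_cat_nat _ _ _ m). Qed.

Lemma psum_le x m n : (m <= n)%N -> psum x m <= psum x n.
Proof. by move=> /psum_cat ->; rewrite lerDl sumr_ge0// => i _; exact: sqr_ge0. Qed.

Lemma psum_term x i : rnorm (x i) ^+ 2 <= psum x i.+1.
Proof. by rewrite /psum big_nat_recr//= lerDr psum_ge0. Qed.

Lemma psum_tail x : sq_summable x -> forall e : R, 0 < e ->
  exists N, forall n, psum x n <= psum x N + e.
Proof.
move=> [M xM] e e0.
have sup : has_sup [set psum x n | n in setT].
  by split; [exists (psum x 0), 0|exists M => _ [n _ <-]].
have [_ [N _ <-] hN] := sup_adherent e0 sup; exists N => n.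
rewrite -lerBlDr (le_trans _ (ltW hN))// lerB//.
by apply: ub_le_sup; [case: sup|exists n].
Qed.

Lemma rnormD_sqr (U : hilbertType R) (u v : U) :
  rnorm (u + v) ^+ 2 <= 2 * rnorm u ^+ 2 + 2 * rnorm v ^+ 2.
Proof. by have := sqr_ge0 (rnorm (u - v)); rewrite sqrB sqrD; lra. Qed.

Lemma psumD x y n : psum (fun i => x i + y i) n <= 2 * psum x n + 2 * psum y n.
Proof.
by rewrite /psum !mulr_sumr -big_split ler_sum// => i _; exact: rnormD_sqr.
Qed.

Lemma psumZ k x n : psum (fun i => k *: x i) n = rnorm k ^+ 2 * psum x n.
Proof. by rewrite /psum mulr_sumr; apply: eq_bigr => i _; rewrite rnormZ exprMn. Qed.

Lemma psumN x n : psum (fun i => - x i) n = psum x n.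
Proof. by apply: eq_bigr => i _; rewrite rnormN. Qed.

Lemma psum0 n : psum (fun=> 0) n = 0.
Proof. by apply: big1 => i _; rewrite rnorm0 expr0n. Qed.

(** Cauchy's criterion, from |<x, y>| <= |x|^2 + |y|^2. *)
Lemma pdot_cvg x y : sq_summable x -> sq_summable y ->
  clim (pdot x y) (climit (pdot x y)).
Proof.
move=> sx sy; apply: clim_cauchy => e e0; have e3 : 0 < e / 3 by rewrite divr_gt0.
have [N xN] := psum_tail sx e3; have [M yM] := psum_tail sy e3.
exists (maxn N M).
suff H m n : (maxn N M <= m)%N -> (m <= n)%N -> rnorm (pdot x y n - pdot x y m) < e.
  by move=> m n hm hn; case/orP: (leq_total m n) => /H; [rewrite rnormB|]; exact.
rewrite geq_max => /andP[Nm Mm] mn.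
have -> : pdot x y n - pdot x y m = \sum_(m <= i < n) hdot (x i) (y i).
  by rewrite /pdot (@big_cat_nat _ _ _ m 0 n)//= addrAC subrr add0r.
rewrite (le_lt_trans (rnorm_sum _ _ _))//.
have : \sum_(m <= i < n) rnorm (hdot (x i) (y i)) <=
    \sum_(m <= i < n) rnorm (x i) ^+ 2 + \sum_(m <= i < n) rnorm (y i) ^+ 2.
  rewrite -big_split ler_sum// => i _; rewrite (le_trans (rnorm_hdot _ _))//=.
  have := sqr_ge0 (rnorm (x i) - rnorm (y i)).
  have := sqr_ge0 (rnorm (x i)); have := sqr_ge0 (rnorm (y i)).
  by rewrite sqrrB mulr2n; lra.
have := xN n; have := yM n; rewrite (psum_cat x mn) (psum_cat y mn).
have := psum_le x Nm; have := psum_le y Mm; lra.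
Qed.

Lemma pdotxx x n : pdot x x n = (psum x n)%:C%C.
Proof. by rewrite /psum rmorph_sum; apply: eq_bigr => i _; rewrite hdotxx. Qed.

End SquareSums.

(** * The l2 direct sum of a sequence of Hilbert spaces *)

Record l2sum (R : realType) (V : nat -> hilbertType R) :=
  L2Sum { l2val :> forall n, V n; l2valP : sq_summable l2val }.

Section L2Sum.
Variables (R : realType) (V : nat -> hilbertType R).
Local Notation S := (l2sum V).
Implicit Types (x y z : S) (k : R[i]).

HB.instance Definition _ := gen_eqMixin S.
HB.instance Definition _ := gen_choiceMixin S.

Lemma l2_eq x y : (forall n, x n = y n) -> x = y.
Proof.
case: x y => [x px] [y py] /= xy; have E : x = y by exact: functional_extensionality_dep.
by subst y; congr L2Sum; exact: Prop_irrelevance.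
Qed.

Lemma sq_summable0 : sq_summable (fun n => 0 : V n).
Proof. by exists 0 => n; rewrite psum0. Qed.

Lemma sq_summableD (x y : forall n, V n) : sq_summable x -> sq_summable y ->
  sq_summable (fun n => x n + y n).
Proof.
move=> [M xM] [N yN]; exists (2 * M + 2 * N) => n.
by rewrite (le_trans (psumD _ _ _))// lerD// ler_pM2l.
Qed.

Lemma sq_summableN (x : forall n, V n) : sq_summable x -> sq_summable (fun n => - x n).
Proof. by move=> [M xM]; exists M => n; rewrite psumN. Qed.

Lemma sq_summableZ k (x : forall n, V n) : sq_summable x ->
  sq_summable (fun n => k *: x n).
Proof.
by move=> [M xM]; exists (rnorm k ^+ 2 * M) => n; rewrite psumZ ler_wpM2l ?sqr_ge0.
Qed.

Definition l2_zero : S := L2Sum sq_summable0.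
Definition l2_add x y : S := L2Sum (sq_summableD (l2valP x) (l2valP y)).
Definition l2_opp x : S := L2Sum (sq_summableN (l2valP x)).
Definition l2_scale k x : S := L2Sum (sq_summableZ k (l2valP x)).

Lemma l2_addA : associative l2_add.
Proof. by move=> x y z; apply: l2_eq => n /=; rewrite addrA. Qed.
Lemma l2_addC : commutative l2_add.
Proof. by move=> x y; apply: l2_eq => n /=; rewrite addrC. Qed.
Lemma l2_add0 : left_id l2_zero l2_add.
Proof. by move=> x; apply: l2_eq => n /=; rewrite add0r. Qed.
Lemma l2_addN : left_inverse l2_zero l2_opp l2_add.
Proof. by move=> x; apply: l2_eq => n /=; rewrite addNr. Qed.

HB.instance Definition _ := GRing.isZmodule.Build S l2_addA l2_addC l2_add0 l2_addN.

Lemma l2_scaleA a b x : l2_scale a (l2_scale b x) = l2_scale (a * b) x.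
Proof. by apply: l2_eq => n /=; rewrite scalerA. Qed.
Lemma l2_scale1 : left_id 1 l2_scale.
Proof. by move=> x; apply: l2_eq => n /=; rewrite scale1r. Qed.
Lemma l2_scaleDr : right_distributive l2_scale +%R.
Proof. by move=> a x y; apply: l2_eq => n /=; rewrite scalerDr. Qed.
Lemma l2_scaleDl x : {morph l2_scale^~ x : a b / a + b}.
Proof. by move=> a b; apply: l2_eq => n /=; rewrite scalerDl. Qed.

HB.instance Definition _ := GRing.Zmodule_isLmodule.Build R[i] S
  l2_scaleA l2_scale1 l2_scaleDr l2_scaleDl.

Definition l2_dot x y : R[i] := climit (pdot x y).

Lemma l2_dot_lim x y : clim (pdot x y) (l2_dot x y).
Proof. by apply: pdot_cvg; exact: l2valP. Qed.

Lemma l2_dotP x y l : clim (pdot x y) l -> l2_dot x y = l.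
Proof. exact: climitE. Qed.

Lemma l2_dotC x y : l2_dot x y = (l2_dot y x)^*.
Proof.
apply: l2_dotP; apply: clim_ext (clim_conj (l2_dot_lim y x)) => n.
by rewrite /pdot rmorph_sum; apply: eq_bigr => i _; rewrite [RHS]hdotC.
Qed.

Lemma l2_dotPl k x y z : l2_dot (k *: x + y) z = k * l2_dot x z + l2_dot y z.
Proof.
apply: l2_dotP.
apply: clim_ext (climD (climM k (l2_dot_lim x z)) (l2_dot_lim y z)) => n.
rewrite /pdot mulr_sumr -big_split; apply: eq_bigr => i _ /=.
by rewrite hdotDl hdotZl.
Qed.

Lemma l2_dot_bilinear :
  bilinear_for ( *%R) (Num.conj \; *%R) (l2_dot : S -> S -> R[i]).
Proof.
split=> [y a x z|x a y z] /=; first exact: l2_dotPl.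
by rewrite l2_dotC l2_dotPl rmorphD rmorphM /= -!l2_dotC.
Qed.

HB.instance Definition _ := bilinear_isBilinear.Build R[i] S S R[i]
  ( *%R) (Num.conj \; *%R) l2_dot l2_dot_bilinear.

Lemma l2_dot_hermitian x y : l2_dot x y = (-1) ^+ false * (l2_dot y x)^*.
Proof. by rewrite expr0 mul1r l2_dotC. Qed.

HB.instance Definition _ := isHermitianSesquilinear.Build R[i] S false
  Num.conj l2_dot l2_dot_hermitian.

(** The number r is the supremum of the partial sums; this is how estimates pass between
    the norm and the partial sums. *)
Lemma l2_dotxx x : exists2 r : R, l2_dot x x = r%:C%C &
  (forall n, psum x n <= r) /\ (forall M, (forall n, psum x n <= M) -> r <= M).
Proof.
have := l2_dot_lim x x; set l := l2_dot x x => xl.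
have imE : complex.Im l = 0.
  apply/eqP; rewrite -normr_le0; apply: le_eps => e /xl[N /(_ N (leqnn N))].
  move=> /(le_lt_trans (rnorm_Im _)); rewrite pdotxx raddfB/= sub0r normrN add0r.
  exact: ltW.
exists (complex.Re l); first by move: imE; case: (l) => a b /= ->.
have near e : 0 < e -> exists N, forall n, (N <= n)%N -> `|psum x n - complex.Re l| < e.
  move=> /xl[N xN]; exists N => n /xN; rewrite pdotxx => /(le_lt_trans (rnorm_Re _)).
  by rewrite raddfB.
split=> [n|M xM]; apply: le_eps => e /near[N hN].
  have := hN (maxn N n) (leq_maxl _ _); have := psum_le x (leq_maxr N n).
  by rewrite ltr_norml => h /andP[h1 h2]; lra.
by have := hN N (leqnn N); have := xM N; rewrite ltr_norml => h /andP[h1 h2]; lra.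
Qed.

Lemma l2_dot_gt0 x : x != 0 -> 0 < l2_dot x x.
Proof.
move=> x0; have [r -> [rx _]] := l2_dotxx x; rewrite ltcR.
have [n xn] : exists n, x n != 0.
  apply: contrapT => /forallNP h; move/negP: x0; apply; apply/eqP/l2_eq => n.
  by apply/eqP; have /negP := h n; rewrite negbK.
by rewrite (lt_le_trans _ (rx n.+1))// (lt_le_trans _ (psum_term _ _))// exprn_gt0// rnorm_gt0.
Qed.

HB.instance Definition _ := isDotProduct.Build R[i] S l2_dot l2_dot_gt0.

Definition l2_norm x : R[i] := sqrtC (l2_dot x x).

Lemma l2_normD x y : l2_norm (x + y) <= l2_norm x + l2_norm y.
Proof. exact: (dot_triangle (l2_dot : {dot S for Num.conj})). Qed.

Lemma l2_normZ k x : l2_norm (k *: x) = `|k| * l2_norm x.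
Proof.
rewrite /l2_norm (dnormZ (l2_dot : {dot S for Num.conj})).
by rewrite sqrtCM ?nnegrE ?exprn_ge0 ?sqrCK ?dnorm_ge0.
Qed.

Lemma l2_norm_eq0 x : l2_norm x = 0 -> x = 0.
Proof. by move/eqP; rewrite sqrtC_eq0 dnorm_eq0 => /eqP. Qed.

HB.instance Definition _ := Lmodule_isNormed.Build R[i] S
  l2_normD l2_normZ l2_norm_eq0.

Lemma l2_dotE x : l2_dot x x = `|x| ^+ 2.
Proof. by rewrite sqrtCK. Qed.

Lemma l2_rnormE x : l2_dot x x = (rnorm x ^+ 2)%:C%C.
Proof. by rewrite l2_dotE rnormE rmorphXn. Qed.

Lemma psum_le_rnorm x n : psum x n <= rnorm x ^+ 2.
Proof. by have [r + [rx _]] := l2_dotxx x; rewrite l2_rnormE => -[->]. Qed.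

Lemma rnorm_le_psum x M : (forall n, psum x n <= M) -> rnorm x ^+ 2 <= M.
Proof. by have [r + [_ rM]] := l2_dotxx x; rewrite l2_rnormE => -[->]; exact: rM. Qed.

Lemma l2_proj_le x n : rnorm (x n) <= rnorm x.
Proof.
rewrite -(ler_pXn2r (n := 2)) ?nnegrE ?rnorm_ge0//.
exact: le_trans (psum_term _ _) (psum_le_rnorm _ _).
Qed.

(** Coordinatewise limits exist.  Being Cauchy bounds all partial square sums of a
    difference at once, so the coordinatewise limit is square summable and is approached in
    norm. *)
Lemma l2_complete (F : set_system S) : ProperFilter F -> cauchy F -> cvg F.
Proof.
move=> FF /cauchyP Fc.
have Fn n : cvg ((fun x : S => x n : V n) @ F).
  apply: cauchy_cvg; apply/cauchyP => e e0.
  have [x Fx] := Fc e e0; exists (x n); rewrite /fmap/=.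
  apply: filterS Fx => y; rewrite -!ball_normE/=; apply: le_lt_trans.
  by rewrite !rnormE lecR; exact: (l2_proj_le (x - y)).
pose a n : V n := lim ((fun x : S => x n : V n) @ F).
have near n (e : R) : 0 < e -> F [set x : S | rnorm (x n - a n) < e].
  move=> e0; have e0' : 0 < e%:C%C by rewrite ltcR.
  have /cvgrPdist_lt/(_ _ e0') := Fn n.
  by apply: filterS => x; rewrite rnormE ltcR rnormB.
have nearp n (e : R) : 0 < e -> F [set x : S | psum (fun i => x i - a i) n <= e].
  elim: n e => [|n ih] e e0.
    by apply: filterE => x /=; rewrite /psum big_geq// ltW.
  have e2 : 0 < e / 2 by rewrite divr_gt0.
  apply: filterS (filterI (ih _ e2) (near n (Num.sqrt (e / 2)) _)).
    move=> x /= [h1 h2]; rewrite /psum big_nat_recr//= [leRHS]splitr lerD//.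
    by rewrite -(sqr_sqrtr (ltW e2)) ler_pXn2r ?nnegrE ?rnorm_ge0 ?sqrtr_ge0 ?ltW.
  by rewrite sqrtr_gt0.
have approx (e : R) : 0 < e -> F [set y : S | forall n, psum (fun i => y i - a i) n <= (4 * e) ^+ 2].
  move=> e0; have e0' : 0 < e%:C%C by rewrite ltcR.
  have [x Fx] := Fc _ e0'; apply: filterS (Fx) => y xy n.
  have e20 : 0 < e ^+ 2 by rewrite exprn_gt0.
  have [z [xz za]] := filter_ex (filterI Fx (nearp n _ e20)).
  have yz : rnorm (y - z) <= 2 * e.
    move: xy xz; rewrite -!ball_normE/= !rnormE !ltcR rnormB => xy xz.
    rewrite -(subrKA x) (le_trans (rnormD _ _))// mulr_natl mulr2n.
    by rewrite lerD// ltW.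
  have := psumD (fun i => y i - z i) (fun i => z i - a i) n.
  have -> : psum (fun i => y i - z i + (z i - a i)) n = psum (fun i => y i - a i) n.
    by apply: eq_bigr => i _; rewrite subrKA.
  have := psum_le_rnorm (y - z) n.
  have -> : psum (y - z) n = psum (fun i => y i - z i) n by [].
  have : rnorm (y - z) ^+ 2 <= (2 * e) ^+ 2.
    by rewrite ler_pXn2r ?nnegrE ?rnorm_ge0 ?mulr_ge0 ?(ltW e0).
  by rewrite /= in za; rewrite !exprMn; lra.
have sa : sq_summable a.
  have [y yP] := filter_ex (approx _ (@ltr01 R)).
  have ya : sq_summable (fun i => y i - a i) by exists ((4 * 1) ^+ 2).
  have [M yM] := sq_summableD (l2valP y) (sq_summableN ya).
  by exists M => n; apply: le_trans (yM n); rewrite (_ : psum _ n = psum a n)//;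
    apply: eq_bigr => i _; rewrite opprB addrC subrK.
apply/cvg_ex; exists (L2Sum sa); apply/cvgrPdist_lt => e e0.
have e0' : (complex.Re e)%:C%C = e by rewrite rcReE// ltW.
have er : 0 < complex.Re e by rewrite -ltcR e0'.
have e8 : 0 < complex.Re e / 8 by rewrite divr_gt0.
apply: filterS (approx _ e8) => y /= ya.
rewrite -e0' rnormE ltcR rnormB.
have /rnorm_le_psum : forall n, psum (y - L2Sum sa) n <= (4 * (complex.Re e / 8)) ^+ 2 by [].
rewrite ler_pXn2r ?nnegrE ?rnorm_ge0 ?mulr_ge0 ?(ltW er)//.
by move/le_lt_trans; apply; lra.
Qed.

HB.instance Definition _ := Uniform_isComplete.Build S l2_complete.

HB.instance Definition _ := isHilbert.Build R S l2_dotE.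

End L2Sum.

(** * Direct sums of representations and completeness of B(G) *)

Section L2Rep.
Variables (R : realType) (G : lcGroupType) (U : nat -> urep R G).
Local Notation S := (l2sum (fun n => urep_space (U n))).
Implicit Types (x y : S).

Lemma psum_act (s : G) (x : forall n, U n) n :
  psum (fun i => urep_act (U i) s (x i)) n = psum x n.
Proof. by apply: eq_bigr => i _; rewrite act_rnorm. Qed.

Lemma sq_summable_act (s : G) (x : forall n, U n) : sq_summable x ->
  sq_summable (fun n => urep_act (U n) s (x n)).
Proof. by move=> [M xM]; exists M => n; rewrite psum_act. Qed.

Definition l2_act (s : G) x : S := L2Sum (sq_summable_act s (l2valP x)).

Lemma l2_act_linear s : linear (l2_act s).
Proof. by move=> a x y; apply: l2_eq => n /=; rewrite linearP. Qed.

HB.instance Definition _ s := GRing.isLinear.Build R[i] S S _ (l2_act s)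
  (l2_act_linear s).

Lemma l2_act1 x : l2_act 1%g x = x.
Proof. by apply: l2_eq => n /=; rewrite urep_act1. Qed.

Lemma l2_actM s t x : l2_act (s * t)%g x = l2_act s (l2_act t x).
Proof. by apply: l2_eq => n /=; rewrite urep_actM. Qed.

Lemma l2_act_dot s x y : hdot (l2_act s x) (l2_act s y) = hdot x y.
Proof.
apply: l2_dotP; apply: clim_ext (l2_dot_lim x y) => n.
by apply: eq_bigr => i _ /=; rewrite urep_act_dot.
Qed.

(** The tails of s x and of x have the same norm, so the tail of s x - t x is small
    uniformly in s and t; finitely many coordinates remain. *)
Lemma l2_act_continuous x : continuous (l2_act^~ x).
Proof.
move=> s; apply/cvgrPdist_lt => e e0.
have e0' : (complex.Re e)%:C%C = e by rewrite rcReE// ltW.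
have er : 0 < complex.Re e by rewrite -ltcR e0'.
set d := complex.Re e in er e0'.
have d8 : 0 < d ^+ 2 / 8 by rewrite divr_gt0 ?exprn_gt0.
have [N xN] := psum_tail (l2valP x) d8.
have near n (c : R) : 0 < c -> \forall t \near s,
    psum (fun i => urep_act (U i) s (x i) - urep_act (U i) t (x i)) n <= c.
  elim: n c => [|n ih] c c0.
    by apply: nearW => t; rewrite /psum big_geq// ltW.
  have c2 : 0 < c / 2 by rewrite divr_gt0.
  have q0 : 0 < (Num.sqrt (c / 2))%:C%C by rewrite ltcR sqrtr_gt0.
  have /cvgrPdist_lt/(_ _ q0) cn := @urep_act_continuous _ _ (U n) (x n) s.
  apply: filterS (filterI (ih _ c2) cn) => t /= [h1 h2].
  rewrite /psum big_nat_recr//= [leRHS]splitr lerD//.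
  rewrite -(sqr_sqrtr (ltW c2)) ler_pXn2r ?nnegrE ?rnorm_ge0 ?sqrtr_ge0//.
  by rewrite ltW// -ltcR -rnormE.
have d4 : 0 < d ^+ 2 / 4 by rewrite divr_gt0 ?exprn_gt0.
apply: filterS (near N _ d4) => t tN.
rewrite -e0' rnormE ltcR -(ltr_pXn2r (n := 2)) ?nnegrE ?rnorm_ge0 ?ltW//.
apply: (@le_lt_trans _ _ (3 * d ^+ 2 / 4)); last by lra.
apply: rnorm_le_psum => n.
apply: (@le_trans _ _ (psum (l2_act s x - l2_act t x) (maxn N n))).
  exact: psum_le (leq_maxr _ _).
rewrite (psum_cat _ (leq_maxl N n)).
have : \sum_(N <= i < maxn N n) rnorm ((l2_act s x - l2_act t x) i) ^+ 2 <=
   4 * \sum_(N <= i < maxn N n) rnorm (x i) ^+ 2.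
  rewrite mulr_sumr ler_sum// => i _.
  have := rnormD_sqr (urep_act (U i) s (x i)) (- urep_act (U i) t (x i)).
  by rewrite rnormN !act_rnorm /= => h; apply: le_trans h _; lra.
have := xN (maxn N n); rewrite (psum_cat _ (leq_maxl N n)).
have : psum (l2_act s x - l2_act t x) N <= d ^+ 2 / 4 by exact: tN.
lra.
Qed.

Definition rsum_l2 : urep R G :=
  @URep R G S l2_act l2_act1 l2_actM l2_act_dot l2_act_continuous.

Lemma coef_rsum_l2 x y s :
  clim (fun n => \sum_(0 <= i < n) coef (x i) (y i) s) (@coef R G rsum_l2 x y s).
Proof. exact: (@l2_dot_lim R (fun n => urep_space (U n)) (l2_act s x) y). Qed.

End L2Rep.

Lemma geometric_tail (R : realType) (m n : nat) :
  \sum_(m <= i < n) (2^-1 ^+ i : R) <= 2 * 2^-1 ^+ m.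
Proof.
have [nm|mn] := leqP n m; first by rewrite big_geq// mulr_ge0// exprn_ge0// invr_ge0.
suff -> : \sum_(m <= i < n) (2^-1 ^+ i : R) = 2 * 2^-1 ^+ m - 2 * 2^-1 ^+ n.
  by rewrite lerBlDr lerDl mulr_ge0// exprn_ge0// invr_ge0.
have -> : \sum_(m <= i < n) (2^-1 ^+ i : R) =
    \sum_(m <= i < n) (- (2 * 2^-1 ^+ i.+1) - - (2 * 2^-1 ^+ i)).
  by apply: eq_bigr => i _; rewrite exprS opprK mulrA mulfV// mul1r addrC mulr_natl mulr2n addrK.
by rewrite telescope_sumr ?(ltnW mn)// opprK addrC.
Qed.

Section FourierStieltjesComplete.
Variables (R : realType) (G : lcGroupType).
Local Notation B := (FS R G).

Lemma fs_rnorm_le (u : B) (pi : urep R G) (x y : pi) :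
  (forall s, u s = coef x y s) -> rnorm u <= rnorm x * rnorm y.
Proof.
move=> uE; have uE' : fsval u = coef x y by apply/funext.
rewrite -lecR rcE -!rnormE; have -> : `|u| = (inf (fs_norms u))%:C%C by [].
rewrite -[leRHS]rcReE ?mulr_ge0// lecR; apply: fs_norms_le; exact: fs_norms_coef.
Qed.

(** The norm of u is an infimum over representations of u as a coefficient, and rescaling
    distributes the product of the two norms evenly over both vectors. *)
Lemma fs_balanced (u : B) (r : R) : rnorm u < r ->
  exists p : {sg : urep R G & (sg * sg)%type},
  [/\ forall s, u s = coef (projT2 p).1 (projT2 p).2 s,
   rnorm (projT2 p).1 ^+ 2 <= r & rnorm (projT2 p).2 ^+ 2 <= r].
Proof.
move=> ur.
have [] := @inf_adherent _ (fs_norms u) (r - rnorm u) _ (fs_norms_inf u).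
  by rewrite subr_gt0.
move=> c [pi [x [y [uE cE]]]].
have -> : inf (fs_norms u) = rnorm u by [].
rewrite addrC subrK => cr.
have [x' [y' [e nx ny]]] := coef_balance x y.
have sq (z : pi) : `|z| ^+ 2 = `|x| * `|y| -> rnorm z ^+ 2 <= r.
  rewrite -cE rnormE -rmorphXn => /complexI ->; exact: ltW.
exists (existT _ pi (x', y')); split=> /=; [|exact: sq|exact: sq].
by move=> s; rewrite uE -e.
Qed.

Lemma fs_sum_val (u : nat -> B) n s :
  (\sum_(0 <= i < n) u i) s = \sum_(0 <= i < n) (u i s : R[i]).
Proof.
elim: n => [|n ih]; first by rewrite !big_geq.
by rewrite !big_nat_recr//= -ih.
Qed.

(** If u n is the coefficient of x n and y n, with both squared norms at most 2 * 2^-n,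
    the sum is the coefficient of the square-summable sequences x and y in the direct sum, and
    the n-th remainder is the coefficient of their tails from n on, whose squared norms are at
    most 4 * 2^-n. *)
Lemma fs_series (u : nat -> B) : (forall n, rnorm (u n) <= 2^-1 ^+ n) ->
  exists v : B, forall n, rnorm (v - \sum_(0 <= i < n) u i) <= 4 * 2^-1 ^+ n.
Proof.
move=> ub.
have /choice[p pP] : forall n, exists p : {sg : urep R G & (sg * sg)%type},
  [/\ forall s, u n s = coef (projT2 p).1 (projT2 p).2 s,
   rnorm (projT2 p).1 ^+ 2 <= 2 * 2^-1 ^+ n & rnorm (projT2 p).2 ^+ 2 <= 2 * 2^-1 ^+ n].
  move=> n; apply: fs_balanced; rewrite (le_lt_trans (ub n))// ltr_pMl ?exprn_gt0 ?invr_gt0//.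
  by rewrite ltr1n.
pose U n := projT1 (p n).
pose x (n : nat) : U n := (projT2 (p n)).1; pose y (n : nat) : U n := (projT2 (p n)).2.
have uE n s : u n s = coef (x n) (y n) s by have [] := pP n.
have xb n : rnorm (x n) ^+ 2 <= 2 * 2^-1 ^+ n by have [] := pP n.
have yb n : rnorm (y n) ^+ 2 <= 2 * 2^-1 ^+ n by have [] := pP n.
(* The tail of a sequence of vectors from the index m on. *)
pose cut (m : nat) (z : forall n, U n) (n : nat) : U n := if (n < m)%N then 0 else z n.
have cutb m z n : (forall n, rnorm (z n) ^+ 2 <= 2 * 2^-1 ^+ n) ->
    psum (cut m z) n <= 4 * 2^-1 ^+ m.
  move=> zb; apply: (@le_trans _ _ (psum (cut m z) (maxn m n))).
    exact: psum_le (leq_maxr _ _).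
  rewrite (psum_cat _ (leq_maxl m n)) [psum _ m]big_nat big1 ?add0r; last first.
    by move=> i /andP[_ im]; rewrite /cut im rnorm0 expr0n.
  apply: (@le_trans _ _ (\sum_(m <= i < maxn m n) 2 * 2^-1 ^+ i)).
    rewrite big_nat [leRHS]big_nat ler_sum// => i /andP[mi _].
    by rewrite /cut ltnNge mi /=.
  by rewrite -mulr_sumr; have := @geometric_tail R m (maxn m n); lra.
have cutS m z : (forall n, rnorm (z n) ^+ 2 <= 2 * 2^-1 ^+ n) -> sq_summable (cut m z).
  by move=> zb; exists (4 * 2^-1 ^+ m) => n; exact: cutb.
pose X m : rsum_l2 U := L2Sum (cutS m x xb); pose Y m : rsum_l2 U := L2Sum (cutS m y yb).
exists (fs_coef (X 0) (Y 0)) => n.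
have sq4 : 4 * 2^-1 ^+ n = Num.sqrt (4 * 2^-1 ^+ n : R) * Num.sqrt (4 * 2^-1 ^+ n).
  by rewrite -expr2 sqr_sqrtr// mulr_ge0// exprn_ge0// invr_ge0.
have sqle (Z : rsum_l2 U) : (forall m, psum Z m <= 4 * 2^-1 ^+ n) ->
    rnorm Z <= Num.sqrt (4 * 2^-1 ^+ n : R).
  by move=> /rnorm_le_psum h; rewrite -(ger0_norm (rnorm_ge0 Z)) -sqrtr_sqr ler_wsqrtr.
apply: (@le_trans _ _ (rnorm (X n) * rnorm (Y n))); last first.
  rewrite sq4 ler_pM ?rnorm_ge0//; apply: sqle => m; exact: cutb.
apply: fs_rnorm_le => s.
have -> : (fs_coef (X 0) (Y 0) - \sum_(0 <= i < n) u i) s =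
   coef (X 0) (Y 0) s - \sum_(0 <= i < n) (u i s : R[i]) by rewrite -fs_sum_val.
have h0 := coef_rsum_l2 (X 0) (Y 0) s; have hn := coef_rsum_l2 (X n) (Y n) s.
apply/eqP; rewrite subr_eq addrC; apply/eqP; apply: clim_unique h0 _.
have hc : clim (fun=> \sum_(0 <= i < n) (u i s : R[i])) (\sum_(0 <= i < n) u i s).
  exact: (@clim_eventually _ _ _ 0%N).
move=> e e0; have [N hN] := climD hc hn e0; exists (maxn n N) => m.
rewrite geq_max => /andP[nm Nm]; have := hN m Nm.
congr (rnorm (_ - _) < _).
rewrite (@big_cat_nat _ _ _ n 0 m)//= [RHS](@big_cat_nat _ _ _ n 0 m)//=.
rewrite [X in _ + (X + _)]big_nat [X in _ + (X + _)]big1 ?add0r; last first.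
  by move=> i /andP[_ im]; rewrite /coef /= /cut im linear0r.
congr (_ + _).
  by apply: eq_bigr => i _; rewrite uE /cut ltn0.
by apply: eq_big_nat => i /andP[ni _]; rewrite /cut ltnNge ni.
Qed.

End FourierStieltjesComplete.

(** * Countably subadditive seminorms and the closed graph theorem *)

Section SeriesComplete.
Variable R : realType.

(** Completeness, for geometrically dominated series only; the factor 4 leaves room for
    the bound that is available in B(G). *)
Definition series_complete (E : normedModType R[i]) := forall u : nat -> E,
  (forall n, rnorm (u n) <= 2^-1 ^+ n) ->
  exists v : E, forall n, rnorm (v - \sum_(0 <= i < n) u i) <= 4 * 2^-1 ^+ n.

Lemma exp2V_gt0 n : 0 < 2^-1 ^+ n :> R.
Proof. by rewrite exprn_gt0// invr_gt0. Qed.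

Lemma le_exp2V (a b c : R) : 0 <= c -> (forall n, a <= b + c * 2^-1 ^+ n) -> a <= b.
Proof.
move=> c0 h; apply: le_eps => e e0; have c1 : 0 < c + 1 by rewrite ltr_wpDl.
have [|N hN] := @small_exp2 R (e / (c + 1)); first by rewrite divr_gt0.
have := hN N (leqnn N); rewrite ltr_pdivlMr// => h1; apply: le_trans (h N) _.
by rewrite lerD2l; have := exp2V_gt0 N; nra.
Qed.

Lemma series_complete_scaled (E : normedModType R[i]) (u : nat -> E) (C : R) :
  series_complete E -> 0 < C -> (forall n, rnorm (u n) <= C * 2^-1 ^+ n) ->
  exists v : E, forall n, rnorm (v - \sum_(0 <= i < n) u i) <= 4 * C * 2^-1 ^+ n.
Proof.
move=> cE C0 uC; have [|v vP] := cE (fun n => (C^-1)%:C%C *: u n).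
  by move=> n; rewrite rnormZ rnormC gtr0_norm ?invr_gt0// ler_pdivrMl.
exists (C%:C%C *: v) => n.
have -> : C%:C%C *: v - \sum_(0 <= i < n) u i =
    C%:C%C *: (v - \sum_(0 <= i < n) (C^-1)%:C%C *: u i).
  rewrite -scaler_sumr scalerBr scalerA -rcE mulfV ?gt_eqF//.
  by rewrite rmorph1 scale1r.
rewrite rnormZ rnormC gtr0_norm//; have := vP n => h.
by rewrite -mulrA mulrCA ler_pM2l.
Qed.

Section Zabreiko.
Variables (E : normedModType R[i]) (q : E -> R).
Hypothesis cE : series_complete E.
Hypothesis qD : forall x y, q (x + y) <= q x + q y.
Hypothesis qZ : forall k x, q (k *: x) <= rnorm k * q x.
Hypothesis q_series : forall x (y : nat -> E) C, 0 < C ->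
  (forall n, q (y n) <= C * 2^-1 ^+ n) ->
  (forall n, rnorm (x - \sum_(0 <= i < n) y i) <= 4 * 2^-1 ^+ n) -> q x <= 4 * C.

(** The argument of Baire: otherwise there are nested balls, the n-th of which misses the
    set where q is at most n, and q exceeds every integer at their common point. *)
Lemma sublevel_somewhere_dense : exists (n : nat) (a : E) (r : R), 0 < r /\
  forall x, rnorm (x - a) <= r -> forall e : R, 0 < e ->
  exists2 y, q y <= n%:R & rnorm (x - y) < e.
Proof.
apply: contrapT => nd.
have next (p : nat * (E * R)) : exists p' : E * R, 0 < p.2.2 ->
    [/\ 0 < p'.2, p'.2 <= p.2.2 / 2, rnorm (p'.1 - p.2.1) <= p.2.2 &
     forall y, rnorm (y - p'.1) <= 2 * p'.2 -> p.1%:R < q y].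
  case: p => n [a r] /=; have [r0|r0] := ltP 0 r; last by exists (a, r).
  apply: contrapT => nP; apply: nd; exists n, a, r; split=> // x xa e e0.
  apply: contrapT => ny; apply: nP; exists (x, Num.min (r / 2) (e / 4)) => _ /=.
  have m0 : 0 < Num.min (r / 2) (e / 4) by rewrite lt_min !divr_gt0.
  split=> //; first by rewrite ge_min lexx.
  move=> y yx; rewrite ltNge; apply/negP => qy; apply: ny; exists y => //.
  have : Num.min (r / 2) (e / 4) <= e / 4 by rewrite ge_min lexx orbT.
  by rewrite rnormB; lra.
have [f fP] := choice next.
pose fix s n : E * R := if n is m.+1 then f (m, s m) else (0, 1).
have s0 n : 0 < (s n).2.
  by elim: n => [|n ih] //=; have [] := fP (n, s n) ih.
have sP n := fP (n, s n) (s0 n).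
pose a n := (s n).1; pose r n := (s n).2.
have r2 n : r n.+1 <= r n / 2 by have [] := sP n.
have ra n : rnorm (a n.+1 - a n) <= r n by have [] := sP n.
have rq n y : rnorm (y - a n.+1) <= 2 * r n.+1 -> n%:R < q y by have [_ _ _] := sP n; apply.
have rm m k : r (m + k)%N <= r m * 2^-1 ^+ k.
  elim: k => [|k ih]; first by rewrite addn0 expr0 mulr1.
  by rewrite addnS exprS (le_trans (r2 _))//; lra.
have [|v vP] := cE (u := fun n => a n.+1 - a n).
  move=> n; apply: le_trans (ra n) _; have := rm 0%N n.
  by rewrite add0n /r /= mul1r.
have tele n : \sum_(0 <= i < n) (a i.+1 - a i) = a n.
  by rewrite telescope_sumr// subr0.
(* The centers a n converge to v, which stays in every doubled ball. *)
have va n : rnorm (v - a n) <= 2 * r n.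
  apply: (@le_exp2V _ _ 4) => // k.
  rewrite -(subrKA (a (n + k)%N)) (le_trans (rnormD _ _))// addrC lerD//.
    have -> : a (n + k)%N - a n = \sum_(n <= i < n + k) (a i.+1 - a i).
      by rewrite telescope_sumr// leq_addr.
    rewrite (le_trans (rnorm_sum _ _ _))//.
    rewrite -[X in \sum_(X <= _ < _) _]add0n big_addn addKn.
    apply: (@le_trans _ _ (\sum_(0 <= i < k) r n * 2^-1 ^+ i)).
      by apply: ler_sum => i _; rewrite (le_trans (ra _))// addnC.
    rewrite -mulr_sumr mulrC ler_pM2r ?s0//.
    by have := @geometric_tail R 0 k; rewrite expr0 mulr1.
  have := vP (n + k)%N; rewrite tele => h; apply: le_trans h _.
  rewrite ler_pM2l// exprD ler_piMl ?(ltW (exp2V_gt0 _))//.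
  by apply: exprn_ile1; lra.
have := rq (Num.truncn (q v)) v (va _).
have := truncnS_gt (q v) => h1 h2.
(* The contradiction: q v exceeds an integer larger than q v. *)
have := rq (Num.truncn (q v)).+1 v (va _); lra.
Qed.

(** Differences move the density of a sublevel set of q from a ball around some point to
    a ball around 0, and scaling moves it to every radius. *)
Lemma halving : exists2 K : R, 0 < K & forall (rho : R) x, 0 < rho -> rnorm x <= rho ->
  exists y, q y <= K * rho /\ rnorm (x - y) <= rho / 2.
Proof.
have [n [a [r [r0 nP]]]] := sublevel_somewhere_dense.
exists ((2 * n%:R + 1) / r) => [|rho x rho0 xrho].
  by rewrite divr_gt0// ltr_wpDl// mulr_ge0.
have c0 : 0 < r / rho by rewrite divr_gt0.
have r4 : 0 < r / 4 by rewrite divr_gt0.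
have [|y1 q1 n1] := nP (a + (r / rho)%:C%C *: x) _ _ r4.
  rewrite addrAC subrr add0r rnormZ rnormC gtr0_norm//.
  by rewrite mulrAC ler_pdivrMr// ler_pM2l.
have [|y2 q2 n2] := nP a _ _ r4; first by rewrite subrr rnorm0 ltW.
exists ((rho / r)%:C%C *: (y1 - y2)); split.
  apply: le_trans (qZ _ _) _; rewrite rnormC gtr0_norm ?divr_gt0//.
  have : q (y1 - y2) <= 2 * n%:R.
    have := qD y1 (- y2); have := qZ (-1) y2.
    rewrite scaleN1r rnormN (_ : rnorm 1 = 1); last by rewrite -[1]/(1%:C%C) rnormC normr1.
    lra.
  move=> h; have -> : (2 * n%:R + 1) / r * rho = rho / r * (2 * n%:R + 1) by ring.
  by rewrite ler_pM2l ?divr_gt0//; lra.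
have -> : x - (rho / r)%:C%C *: (y1 - y2) =
   (rho / r)%:C%C *: ((a + (r / rho)%:C%C *: x - y1) - (a - y2)).
  have -> : a + (r / rho)%:C%C *: x - y1 - (a - y2) = (r / rho)%:C%C *: x - (y1 - y2).
    rewrite !opprB [a + _]addrC -!addrA; congr (_ + _).
    by rewrite addrC -addrA subrK addrC.
  rewrite [RHS]scalerBr scalerA -rcE mulrA divfK ?gt_eqF// mulfV ?gt_eqF//.
  by rewrite rmorph1 scale1r.
rewrite rnormZ rnormC gtr0_norm ?divr_gt0//.
have := rnormD (a + (r / rho)%:C%C *: x - y1) (- (a - y2)); rewrite rnormN => h.
rewrite mulrAC ler_pdivrMr// mulrAC; apply: le_trans (_ : rho * (r / 2) <= _); last by lra.
by rewrite ler_pM2l//; lra.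
Qed.

(** Zabreiko's lemma: a countably subadditive seminorm on a Banach space is bounded.
    Iterated halving writes x as the sum of a series along which q decreases
    geometrically. *)
Lemma zabreiko : exists C : R, forall x, q x <= C * rnorm x.
Proof.
have [K K0 hK] := halving.
have step (p : nat * E) : exists y, rnorm p.2 <= 2^-1 ^+ p.1 ->
    q y <= K * 2^-1 ^+ p.1 /\ rnorm (p.2 - y) <= 2^-1 ^+ p.1.+1.
  case: p => n x /=; have [xn|xn] := leP (rnorm x) (2^-1 ^+ n); last by exists 0; lra.
  have [y [qy xy]] := hK _ _ (exp2V_gt0 n) xn.
  by exists y => _; split=> //; rewrite exprS mulrC.
have [f fP] := choice step.
have unit x : rnorm x <= 1 -> q x <= 4 * K.
  move=> x1; pose fix s n := if n is m.+1 then s m - f (m, s m) else x.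
  have sn n : rnorm (s n) <= 2^-1 ^+ n.
    by elim: n => [|n ih]; [rewrite expr0|have [] := fP (n, s n) ih].
  apply: (@q_series x (fun n => f (n, s n))) => // n.
    by have [] := fP (n, s n) (sn n).
  have -> : x - \sum_(0 <= i < n) f (i, s i) = s n.
    elim: n => [|n ih]; first by rewrite big_geq// subr0.
    by rewrite big_nat_recr//= opprD addrA ih.
  by apply: le_trans (sn n) _; rewrite ler_peMl ?(ltW (exp2V_gt0 _))// ler1n.
exists (4 * K) => x; have [->|x0] := eqVneq x 0.
  by rewrite rnorm0 mulr0; have := qZ 0 0; rewrite scaler0 rnorm0 mul0r.
have xp : 0 < rnorm x by rewrite rnorm_gt0.
have xE : x = (rnorm x)%:C%C *: ((rnorm x)^-1%:C%C *: x).
  by rewrite scalerA -rcE mulfV ?gt_eqF// rmorph1 scale1r.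
rewrite {1}xE; apply: le_trans (qZ _ _) _; rewrite rnormC gtr0_norm// mulrC ler_pM2r//.
by apply: unit; rewrite rnormZ rnormC gtr0_norm ?invr_gt0// mulVf// gt_eqF.
Qed.

End Zabreiko.

(** The seminorm |T x| is countably subadditive: if the norms |T y_n| are dominated
    geometrically, the series of the T y_n converges, and the functionals ev i identify its
    sum with T x. *)
Lemma closed_graph (E F : normedModType R[i]) (I : Type) (ev : I -> {linear F -> R[i]^o})
    (T : {linear E -> F}) :
  series_complete E -> series_complete F ->
  (forall y, (forall i, ev i y = 0) -> y = 0) ->
  (forall i, exists C : R, forall y, rnorm (ev i y : R[i]) <= C * rnorm y) ->
  (forall i, exists C : R, forall x, rnorm (ev i (T x) : R[i]) <= C * rnorm x) ->
  exists C : R, forall x, rnorm (T x) <= C * rnorm x.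
Proof.
move=> cE cF sep evC evT; apply: (@zabreiko E (fun x => rnorm (T x))) => //.
- by move=> x y; rewrite linearD; exact: rnormD.
- by move=> k x; rewrite linearZ rnormZ.
move=> x y C C0 yC xy.
have [s sP] := series_complete_scaled cF C0 yC.
have -> : T x = s; last first.
  by have := sP 0%N; rewrite big_geq// subr0 expr0 mulr1.
apply/eqP; rewrite -subr_eq0; apply/eqP/sep => i.
have [A hA] := evC i; have [B hB] := evT i.
apply/eqP; rewrite -rnorm_eq0 eq_le rnorm_ge0 andbT.
apply: (@le_exp2V _ _ (`|B| * 4 + `|A| * (4 * C))) => [|n].
  by rewrite addr_ge0// ?mulr_ge0// ltW.
have -> : T x - s = T (x - \sum_(0 <= j < n) y j) - (s - \sum_(0 <= j < n) T (y j)).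
  by rewrite linearB linear_sum opprB addrA subrK.
rewrite add0r linearB (le_trans (rnormD _ _))// rnormN mulrDl lerD//.
  rewrite (le_trans (hB _))// -mulrA (le_trans (ler_wpM2r (rnorm_ge0 _) (ler_norm B)))//.
  by rewrite ler_wpM2l.
rewrite (le_trans (hA _))// -mulrA (le_trans (ler_wpM2r (rnorm_ge0 _) (ler_norm A)))//.
by rewrite ler_wpM2l.
Qed.

End SeriesComplete.

(** * The Banach algebra A_pi and its characters *)

Section Evaluation.
Variables (R : realType) (G : lcGroupType) (pi : urep R G).

Lemma omega_linear (h : G) : linear (@omega R G h).
Proof. by []. Qed.

HB.instance Definition _ h := GRing.isLinear.Build R[i] (FS R G) R[i]^o _ (@omega R G h)
  (omega_linear h).

Definition Api_eval (s : G) (u : Api pi) : R[i]^o := u s.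

Lemma Api_eval_linear s : linear (Api_eval s).
Proof. by []. Qed.

HB.instance Definition _ s := GRing.isLinear.Build R[i] (Api pi) R[i]^o _ (Api_eval s)
  (Api_eval_linear s).

Lemma fs_eval_rnorm (u : FS R G) s : rnorm (u s : R[i]) <= rnorm u.
Proof. by rewrite -lecR -!rnormE; exact: fs_eval_le. Qed.

Lemma fs_eq0 (u : FS R G) : (forall s, u s = 0) -> u = 0.
Proof. by move=> u0; apply: val_inj; apply/funext => s; exact: u0. Qed.

Lemma Api_rnorm (u : Api pi) : rnorm u = rnorm (apival u).
Proof. by []. Qed.

Lemma Api_eq (u v : Api pi) : (forall s, u s = v s) -> u = v.
Proof. by move=> uv; apply: val_inj; apply: val_inj; apply/funext. Qed.

Lemma Api_evalD (u v : Api pi) s : (u + v) s = u s + v s :> R[i]^o.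
Proof. by []. Qed.

Lemma Api_evalB (u v : Api pi) s : (u - v) s = u s - v s :> R[i]^o.
Proof. by []. Qed.

Lemma fs_series_complete : series_complete (FS R G).
Proof. exact: fs_series. Qed.

Lemma Api_series_complete : series_complete (Api pi).
Proof.
move=> u uN; have [v vP] := @fs_series R G (fun n => apival (u n)) uN.
suff vA : v \in Api_pred pi.
  exists (MkApi vA) => n; rewrite Api_rnorm; have := vP n; congr (rnorm _ <= _).
  by congr (_ - _); elim: (n) => [|m ih]; [rewrite !big_geq|rewrite !big_nat_recr//= -ih].
apply/Api_predP => W cW sW piW; apply: (cW) => B /nbhs_ballP[e /= e0 eB].
have e0' : (complex.Re e)%:C%C = e by rewrite rcReE// ltW.
have [|N hN] := @small_exp2 R (complex.Re e / 4).
  by rewrite divr_gt0// -ltcR e0'.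
exists (\sum_(0 <= i < N) apival (u i)); split.
  have [/set_mem W0 Wlin] := sW.
  elim: (N) => [|n ih]; first by rewrite big_geq.
  rewrite big_nat_recr//= -[X in X + _]scale1r; apply/set_mem/Wlin; apply/mem_set => //.
  by have /Api_predP := apivalP (u n); apply.
apply: eB; rewrite -ball_normE /= rnormE -e0' ltcR (le_lt_trans (vP N))//.
by have := hN N (leqnn N); lra.
Qed.

End Evaluation.

Section BanachAlgebra.
Variables (R : realType) (G : lcGroupType) (pi : urep R G).
Hypothesis A_subalgebra : subalgebra pi.
Local Notation A := (Api pi).

Lemma mul_exists : exists mul : A -> A -> A, forall u v : A, is_mul u v (mul u v).
Proof.
have /choice[f fP] : forall p : A * A, exists w : A, is_mul p.1 p.2 w.
  by move=> p; exact: A_subalgebra.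
by exists (fun u v => f (u, v)) => u v; exact: (fP (u, v)).
Qed.

Lemma mul_bounded (mul : A -> A -> A) : (forall u v : A, is_mul u v (mul u v)) ->
  forall u, exists C : R, forall v, rnorm (mul u v) <= C * rnorm v.
Proof.
move=> mulP u.
have lin : linear (mul u).
  move=> k v w; apply: Api_eq => s; rewrite mulP.
  rewrite -[X in _ * X]/(k * v s + w s : R[i]) -[RHS]/(k * mul u v s + mul u w s) !mulP.
  by rewrite mulrDr mulrCA.
pose T : {linear A -> A} := HB.pack (mul u) (GRing.isLinear.Build _ _ _ _ _ lin).
apply: (@closed_graph R A A G (fun s => @Api_eval R G pi s) T).
- exact: Api_series_complete.
- exact: Api_series_complete.
- by move=> v v0; apply: Api_eq => s; exact: v0.
- by move=> s; exists 1 => v; rewrite mul1r; exact: fs_eval_rnorm.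
- move=> s; exists (rnorm (u s : R[i])) => v.
  rewrite [X in rnorm X](mulP u v s : Api_eval s (T v) = u s * v s).
  rewrite rnormM ler_wpM2l ?rnorm_ge0//; exact: fs_eval_rnorm.
Qed.

(** The uniform boundedness principle for the multiplication operators: the operator norm
    of multiplication by u is a countably subadditive seminorm of u. *)
Lemma mul_jointly_bounded (mul : A -> A -> A) : (forall u v : A, is_mul u v (mul u v)) ->
  exists C : R, forall u v, rnorm (mul u v) <= C * rnorm u * rnorm v.
Proof.
move=> mulP; have mulb := mul_bounded mulP.
have mulC u v : mul u v = mul v u by apply: Api_eq => s; rewrite !mulP mulrC.
pose S u := [set rnorm (mul u v) | v in [set v : A | rnorm v <= 1]].
have supS u : has_sup (S u).
  split; first by exists (rnorm (mul u 0)), 0 => //=; rewrite rnorm0.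
  have [C hC] := mulb u; exists `|C| => _ [v /= v1 <-].
  rewrite (le_trans (hC v))// (le_trans (ler_wpM2r (rnorm_ge0 _) (ler_norm C)))//.
  by rewrite ler_piMr.
have leS u v : rnorm v <= 1 -> rnorm (mul u v) <= sup (S u).
  by move=> v1; apply: ub_le_sup; [case: (supS u)|exists v].
have Sle u M : (forall v, rnorm v <= 1 -> rnorm (mul u v) <= M) -> sup (S u) <= M.
  by move=> h; apply: ge_sup; [case: (supS u)|move=> _ [v v1 <-]; exact: h].
have mulD u v w : mul (u + v) w = mul u w + mul v w.
  by apply: Api_eq => s; rewrite mulP /= mulrDl -!mulP.
have mulZ k u w : mul (k *: u) w = k *: mul u w.
  by apply: Api_eq => s; rewrite mulP /= -mulrA -mulP.
have [||x y C C0 yC xy|C hC] := @zabreiko R A (fun u => sup (S u)) (@Api_series_complete R G pi).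
- by move=> u v; apply: Sle => w w1; rewrite mulD (le_trans (rnormD _ _))// lerD// leS.
- move=> k u; apply: Sle => w w1; rewrite mulZ rnormZ.
  by rewrite ler_wpM2l ?rnorm_ge0// leS.
- apply: Sle => w w1; have [D hD] := mulb w.
  apply: (@le_exp2V _ _ _ (`|D| * 4)) => [|n]; first by rewrite mulr_ge0.
  have -> : mul x w = mul (\sum_(0 <= i < n) y i) w + mul (x - \sum_(0 <= i < n) y i) w.
    by rewrite -mulD addrC subrK.
  rewrite (le_trans (rnormD _ _))// lerD//; last first.
    rewrite mulC (le_trans (hD _))// (le_trans (ler_wpM2r (rnorm_ge0 _) (ler_norm D)))//.
    by rewrite -mulrA ler_wpM2l.
  have -> : mul (\sum_(0 <= i < n) y i) w = \sum_(0 <= i < n) mul (y i) w.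
    elim: (n) => [|m ih]; last by rewrite !big_nat_recr//= mulD ih.
    by rewrite !big_geq//; apply: Api_eq => s; rewrite mulP /= mul0r.
  rewrite (le_trans (rnorm_sum _ _ _))//.
  apply: (@le_trans _ _ (\sum_(0 <= i < n) C * 2^-1 ^+ i)).
    by apply: ler_sum => i _; apply: le_trans (yC i); exact: leS.
  by rewrite -mulr_sumr; have := @geometric_tail R 0 n; rewrite expr0; nra.
exists C => u v; have [->|v0] := eqVneq v 0.
  rewrite (_ : mul u 0 = 0) ?rnorm0 ?mulr0//.
  by apply: Api_eq => s; rewrite mulP /= mulr0.
have vp : 0 < rnorm v by rewrite rnorm_gt0.
have -> : mul u v = (rnorm v)%:C%C *: mul u ((rnorm v)^-1%:C%C *: v).
  by rewrite [in RHS]mulC -mulZ scalerA -rcE mulfV ?gt_eqF// rmorph1 scale1r mulC.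
rewrite rnormZ rnormC gtr0_norm// mulrC ler_pM2r//.
apply: le_trans (hC u); apply: leS.
by rewrite rnormZ rnormC gtr0_norm ?invr_gt0// mulVf// gt_eqF.
Qed.

(** If T u were large compared with the norm of u, the multiple w of u with T w = 1 would
    be so small that the geometric series v = w + w^2 + ... converges, and applying T to
    v = w + w v would give T v = 1 + T v. *)
Lemma character_bounded (T : A -> R[i]^o) : linear T ->
  (forall u v w : A, is_mul u v w -> T w = (T u * T v)%R) ->
  exists C : R, forall u, rnorm (T u : R[i]) <= C * rnorm u.
Proof.
move=> linT mulT; have [mul mulP] := mul_exists.
have [C0 hC0] := mul_jointly_bounded mulP.
pose C := `|C0| + 1.
have C1 : 1 <= C by rewrite lerDr.
have hC u v : rnorm (mul u v) <= C * (rnorm u * rnorm v).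
  rewrite (le_trans (hC0 u v))// -mulrA ler_wpM2r ?mulr_ge0 ?rnorm_ge0//.
  by rewrite (le_trans (ler_norm _))// lerDl.
exists (2 * C) => u; rewrite leNgt; apply/negP => Tu.
have Tu0 : T u != 0.
  rewrite -rnorm_gt0 (le_lt_trans _ Tu)// !mulr_ge0 ?rnorm_ge0//.
  exact: le_trans ler01 C1.
have TZ k x : T (k *: x) = k * T x.
  have T0 : T 0 = 0.
    by have h := linT 1 0 0; apply: (addrI (T 0)); rewrite !scale1r !addr0 in h *; rewrite -h.
  by have := linT k x 0; rewrite T0 !addr0.
pose w := (T u : R[i])^-1 *: u.
have Tw : T w = 1 by rewrite TZ mulVf.
have wC : 2 * C * rnorm w <= 1.
  have Tup : 0 < rnorm (T u : R[i]) by rewrite rnorm_gt0.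
  have -> : rnorm w = rnorm u / rnorm (T u : R[i]).
    apply: (mulIf (lt0r_neq0 Tup)); rewrite divfK ?gt_eqF//.
    rewrite mulrC -rnormZ /w scalerA mulfV// scale1r; done.
  by rewrite mulrA ler_pdivrMr// mul1r ltW.
have w1 : rnorm w <= 1.
  by apply: le_trans wC; rewrite ler_peMl ?rnorm_ge0//; lra.
have mulDr a b : mul w (a + b) = mul w a + mul w b.
  apply: Api_eq => s; rewrite mulP -[X in _ * X]/(a s + b s : R[i]).
  by rewrite -[RHS]/(mul w a s + mul w b s : R[i]) !mulP mulrDr.
(* The power w^(n+1). *)
pose p n := iter n (mul w) w.
have [|v vP] := @Api_series_complete R G pi p.
  elim=> [|n ih]; first by rewrite expr0.
  rewrite /p iterS -/(p n) (le_trans (hC _ _))// exprS.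
  have := ler_wpM2r (rnorm_ge0 (p n)) wC; have := exp2V_gt0 R n; lra.
have vE : v = w + mul w v.
  apply: Api_eq => s; apply/eqP; rewrite -subr_eq0 -rnorm_eq0 eq_le rnorm_ge0 andbT.
  apply: (@le_exp2V _ _ _ (4 + rnorm (w s : R[i]) * 4)) => [|n].
    by rewrite addr_ge0// mulr_ge0// rnorm_ge0.
  pose q := \sum_(0 <= i < n) p i.
  have qS : \sum_(0 <= i < n.+1) p i = w + mul w q.
    rewrite /q big_nat_recl//=; congr (_ + _).
    elim: (n) => [|m ih]; last first.
      by rewrite !big_nat_recr//= ih mulDr.
    by rewrite !big_geq//; apply: Api_eq => t; rewrite mulP /= mulr0.
  have -> : v s - (w + mul w v) s =
     (v - \sum_(0 <= i < n.+1) p i) s - (mul w (v - q)) s.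
    have {1}-> : mul w v = mul w q + mul w (v - q) by rewrite -mulDr addrC subrK.
    by rewrite qS !Api_evalB !Api_evalD !opprD !addrA.
  rewrite add0r (le_trans (rnormD _ _))// rnormN mulrDl lerD//.
    rewrite (le_trans (fs_eval_rnorm _ _))// (le_trans (vP n.+1))// exprS.
    by have := exp2V_gt0 R n; lra.
  rewrite mulP rnormM -mulrA ler_wpM2l ?rnorm_ge0//.
  by rewrite (le_trans (fs_eval_rnorm _ _))// (le_trans (vP n)).
have : T v = 1 + T v.
  rewrite {1}vE -[w]scale1r linT scale1r -[_ *: _]/(1 * T w) Tw mulr1.
  by rewrite (mulT _ _ _ (mulP w v)) Tw mul1r.
move/(congr1 (fun z : R[i] => z - T v)); rewrite subrr addrK => /esym/eqP.
by rewrite oner_eq0.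
Qed.

End BanachAlgebra.

(** * Homomorphisms into B(H) *)

Section Homomorphisms.
Variables (R : realType) (G H : lcGroupType) (pi : urep R G).
Hypothesis A_subalgebra : subalgebra pi.
Variable phi : {linear Api pi -> FS R H}.

Lemma bounded_map_rnorm (E F : normedModType R[i]) (f : E -> F) (C : R) :
  (forall x, rnorm (f x) <= C * rnorm x) -> bounded_map f.
Proof. by move=> fC; exists C%:C%C => x; rewrite !rnormE -rcE lecR. Qed.

Lemma fs_continuous (u : FS R H) : continuous (u : H -> R[i]^o).
Proof.
have /fs_predP[sigma [x [y ->]]] := fsvalP u.
move=> s; apply/cvgrPdist_lt => e e0.
have y0 : 0 < `|y| + 1 by rewrite ltr_wpDl.
have e1 : 0 < e / (`|y| + 1) by rewrite divr_gt0.
have /cvgrPdist_lt/(_ _ e1) := @urep_act_continuous _ _ sigma x s.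
apply: filterS => t; rewrite ltr_pdivlMr// => xt.
rewrite /coef -hdotBl (le_lt_trans _ xt)//.
apply: le_trans (_ : `|urep_act sigma s x - urep_act sigma t x| * `|y| <= _).
  by rewrite [X in X * _]hilbert_normE [X in _ * X]hilbert_normE dot_CauchySchwarz.
by rewrite ler_wpM2l// lerDl.
Qed.

Lemma adjoint_omega_linear h : linear (adjoint phi (omega h)).
Proof. by move=> k u v; rewrite /adjoint /= linearP. Qed.

Lemma adjoint_omega_bounded h : algebra_hom phi ->
  exists C : R, forall u, rnorm (adjoint phi (omega h) u : R[i]) <= C * rnorm u.
Proof.
move=> hom; apply: character_bounded => //; first exact: adjoint_omega_linear.
by move=> u v w uvw; exact: hom.
Qed.

(** Point evaluations separate B(H) and, composed with phi, are bounded because they are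
    multiplicative. *)
Lemma hom_bounded : algebra_hom phi -> bounded_map phi.
Proof.
move=> hom; suff [C hC] : exists C : R, forall u, rnorm (phi u) <= C * rnorm u.
  exact: bounded_map_rnorm hC.
apply: (@closed_graph R _ _ H (fun h => @omega R H h)).
- exact: Api_series_complete.
- exact: fs_series_complete.
- by move=> u u0; apply: fs_eq0.
- by move=> h; exists 1 => u; rewrite mul1r; exact: fs_eval_rnorm.
- by move=> h; exact: adjoint_omega_bounded.
Qed.

Lemma hom_spectrum h : algebra_hom phi ->
  spectrum pi (adjoint phi (omega h)) \/ adjoint phi (omega h) = 0.
Proof.
move=> hom; have [->|n0] := pselect (adjoint phi (omega h) = 0); [by right|left].
split=> //; last by move=> u v w uvw; exact: hom.
split; first exact: adjoint_omega_linear.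
have [C hC] := adjoint_omega_bounded h hom.
by exists C%:C%C => u; rewrite !rnormE -rcE lecR.
Qed.

Lemma jmapE (Y : set H) (alpha : Y -> spectrum pi) (y : Y) u :
  jmap alpha u (\val y) = \val (alpha y) u.
Proof.
rewrite /jmap; case: pselect => [Yh|]; last by case; exact: set_mem (valP y).
by congr (\val (alpha _) u); apply: val_inj.
Qed.

Lemma jmap_out (Y : set H) (alpha : Y -> spectrum pi) h u :
  ~ Y h -> jmap alpha u h = 0.
Proof. by rewrite /jmap; case: pselect. Qed.

Lemma jmap_in (Y : set H) (alpha : Y -> spectrum pi) h : Y h ->
  exists2 y : Y, \val y = h & forall u, jmap alpha u h = \val (alpha y) u.
Proof. by move=> Yh; exists (exist _ h (mem_set Yh)) => // u; rewrite -jmapE. Qed.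

Lemma spectrum_represents :
  (forall h, spectrum pi (adjoint phi (omega h)) \/ adjoint phi (omega h) = 0) ->
  exists (Y : set H) (alpha : Y -> spectrum pi), represents phi alpha.
Proof.
move=> spec; pose Y := [set h | adjoint phi (omega h) <> 0].
have Yspec (y : Y) : adjoint phi (omega (\val y)) \in spectrum pi.
  by apply/mem_set; have [//|y0] := spec (\val y); have := set_mem (valP y).
pose alpha (y : Y) : spectrum pi :=
  exist (fun T => T \in spectrum pi) _ (Yspec y).
exists Y, alpha; split.
- rewrite openE => h /= Yh.
  have [u uh] : exists u, phi u h != 0.
    apply: contrapT => /forallNP n0; apply: Yh; apply/funext => u.
    by apply/eqP; have /negP := n0 u; rewrite negbK.
  have uh0 : 0 < `|phi u h : R[i]| by rewrite normr_gt0.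
  have /cvgrPdist_lt/(_ _ uh0) := @fs_continuous (phi u) h.
  apply: filterS => t /= ut t0; move: ut.
  have -> : phi u t = 0 by have := congr1 (fun f => f u) t0.
  by rewrite subr0 ltxx.
- apply: continuous_comp_initial.
  move=> y; have FF : Filter ((set_val \o alpha) @ y) by apply: fmap_filter; exact: nbhs_filter.
  apply/pointwise_cvgP => u.
  have c1 := @initial_continuous Y H set_val y.
  have c2 := @fs_continuous (phi u) (\val y).
  exact: (cvg_comp _ _ c1 c2).
- move=> u h; have [Yh|nY] := pselect (Y h).
    by have [y <- ->] := jmap_in alpha Yh.
  rewrite jmap_out//; have /contrapT/(congr1 (fun f => f u)) := nY; exact.
Qed.

Lemma represents_hom (Y : set H) (alpha : Y -> spectrum pi) :
  represents phi alpha -> algebra_hom phi.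
Proof.
move=> [_ _ phiE] u v w uvw h; rewrite !phiE.
have [Yh|nY] := pselect (Y h); last by rewrite !jmap_out// mul0r.
have [y _ yE] := jmap_in alpha Yh; rewrite !yE.
by have [_ _ mulT] := set_mem (valP (alpha y)); exact: mulT.
Qed.

Lemma represents_adjoint (Y : set H) (alpha : Y -> spectrum pi) (y : Y) :
  represents phi alpha -> \val (alpha y) = adjoint phi (omega (\val y)).
Proof.
by move=> [_ _ phiE]; apply/funext => u; rewrite -jmapE -phiE.
Qed.

Lemma represents_domain (Y : set H) (alpha : Y -> spectrum pi) :
  represents phi alpha -> Y = [set h | adjoint phi (omega h) <> 0].
Proof.
move=> rep; have [_ _ phiE] := rep; apply/seteqP; split=> h /=.
  move=> Yh; have [y yh _] := jmap_in alpha Yh.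
  by rewrite -yh -(represents_adjoint y rep); have [] := set_mem (valP (alpha y)).
apply: contra_notP => nY; apply/funext => u.
by rewrite /adjoint /= /omega phiE jmap_out.
Qed.

(** With e the identity of A, the function phi e is idempotent and Y is the set where it
    is 1, since a nonzero multiplicative functional takes the value 1 at e. *)
Lemma represents_Omega (Y : set H) (alpha : Y -> spectrum pi) :
  represents phi alpha -> unital pi -> Omega H Y.
Proof.
move=> rep [e eP]; have hom := represents_hom rep; have [_ _ phiE] := rep.
suff -> : Y = [set h | phi e h = 1].
  by apply: idempotent_Omega => h; rewrite -(hom _ _ _ (eP e)).
apply/seteqP; split=> h /=; last first.
  apply: contraPP => nY; rewrite phiE jmap_out// => /eqP.
  by rewrite eq_sym oner_eq0.
move=> Yh; have [y _ yE] := jmap_in alpha Yh; rewrite phiE yE.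
have [_ T0 mulT] := set_mem (valP (alpha y)).
have [u uT] : exists u, \val (alpha y) u != 0.
  apply: contrapT => /forallNP n0; apply: T0; apply/funext => u.
  by apply/eqP; have /negP := n0 u; rewrite negbK.
apply: (mulIf uT); rewrite mul1r; exact/esym/mulT.
Qed.

End Homomorphisms.

Theorem proposition1p8 (R : realType) (G H : lcGroupType) (pi : urep R G)
    (A_subalgebra : subalgebra pi) (phi : {linear Api pi -> FS R H}) :
  [<-> algebra_hom phi;
       bounded_map phi /\
         (forall h : H, spectrum pi (adjoint phi (omega h)) \/
                        adjoint phi (omega h) = 0);
       exists (Y : set H) (alpha : Y -> spectrum pi), represents phi alpha]
  /\
  (algebra_hom phi ->
   forall (Y : set H) (alpha : Y -> spectrum pi), represents phi alpha ->
   [/\ Y = [set h | adjoint phi (omega h) <> 0],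
       forall y : Y, \val (alpha y) = adjoint phi (omega (\val y)) &
       unital pi -> Omega H Y]).
Proof.
split.
  tfae.
  - by move=> hom; split; [exact: hom_bounded|move=> h; exact: hom_spectrum].
  - by move=> [_ spec]; exact: spectrum_represents.
  - by move=> [Y [alpha rep]]; exact: represents_hom rep.
move=> _ Y alpha rep; split.
- exact: represents_domain rep.
- by move=> y; exact: represents_adjoint.
- exact: represents_Omega rep.
Qed.
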